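(* Let $\eta,\zeta\ge 1$ be integers, and consider a continuous-stage Runge-Kutta-Nyström (csRKN) method with coefficients $(\bar{A}_{\tau,\sigma},\bar{B}_\tau,B_\tau,C_\tau)$ such that $B_\tau=1$ and $C_\tau=\tau$ for $\tau\in[0,1]$, and $\bar{A}_{\tau,\sigma}\in L^2([0,1]\times[0,1])$. Then the following two statements are equivalent: (I) Both $\mathcal{CN}(\eta)$ and $\mathcal{DN}(\zeta)$ hold. (II) The coefficient $\bar{A}_{\tau,\sigma}$ admits an expansion of the form $$\begin{aligned} \bar{A}_{\tau,\sigma}={}&\frac{1}{6}-\frac{1}{2}\xi_1P_1(\sigma)+\frac{1}{2}\xi_1P_1(\tau) +\sum_{\iota=1}^{N_1}\xi_{\iota}\xi_{\iota+1}P_{\iota-1}(\tau)P_{\iota+1}(\sigma)\\ &-\sum_{\iota=1}^{N_2}\big(\xi_{\iota}^2+\xi_{\iota+1}^2\big)P_{\iota}(\tau)P_{\iota}(\sigma) +\sum_{\iota=1}^{N_3}\xi_{\iota}\xi_{\iota+1}P_{\iota+1}(\tau)P_{\iota-1}(\sigma)\\ &+\sum_{i\geq\zeta-1,\; j\geq\eta-1}\omega_{(i,j)}P_i(\tau)P_j(\sigma), \end{aligned}$$ where $N_1=\max\{\eta-3,\zeta-1\}$, $N_2=\max\{\eta-2,\zeta-2\}$, $N_3=\max\{\eta-1,\zeta-3\}$, $\xi_\iota=\frac{1}{2\sqrt{4\iota^2-1}}$, and the $\omega_{(i,j)}$ are arbitrary real numbers (for which the series converges in $L^2([0,1]\times[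0,1])$).
   Context: A csRKN method for $q''=f(t,q)$, $q(t_0)=q_0$, $q'(t_0)=q_0'$, with coefficient functions $\bar{A}_{\tau,\sigma}$ (of $\tau,\sigma\in[0,1]$) and $\bar{B}_\tau,B_\tau,C_\tau$ (of $\tau\in[0,1]$) is, with step size $h$, $$Q_\tau=q_0+hC_\tau q_0'+h^2\int_0^1\bar{A}_{\tau,\sigma}f(t_0+C_\sigma h,Q_\sigma)\,d\sigma,\quad \tau\in[0,1],$$ $$q_1=q_0+hq_0'+h^2\int_0^1\bar{B}_\tau f(t_0+C_\tau h,Q_\tau)\,d\tau,\qquad q_1'=q_0'+h\int_0^1 B_\tau f(t_0+C_\tau h,Q_\tau)\,d\tau.$$ The simplifying assumptions are, for $\tau,\sigma\in[0,1]$: $\mathcal{CN}(\eta)$: $\displaystyle\int_0^1\bar{A}_{\tau,\sigma}C_\sigma^{\kappa-1}\,d\sigma=\frac{C_\tau^{\kappa+1}}{\kappa(\kappa+1)}$ for all integers $1\le\kappa\le\eta-1$; $\mathcal{DN}(\zeta)$: $\displaystyle\int_0^1B_\tau C_\tau^{\kappa-1}\bar{A}_{\tau,\sigma}\,d\tau=\frac{B_\sigma C_\sigma^{\kappa+1}}{\kappa(\kappa+1)}-\frac{B_\sigma C_\sigma}{\kappa}+\frac{B_\sigma}{\kappa+1}$ for all integers $1\le\kappa\le\zeta-1$. $P_\iota$ denotes the normalized shifted Legendre polynomial of degree $\iota$ on $[0,1]$: $P_0(t)=1$, $P_\iota(t)=\frac{\sqrt{2\iota+1}}{\iota!}\frac{d^\iota}{dt^\iota}\big(t^\iota(t-1)^\iota\big)$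 for $\iota\ge1$, so that $\int_0^1P_\iota P_\kappa\,dt=\delta_{\iota\kappa}$. Sums whose upper limit is smaller than the lower limit are zero. Identities between functions are understood in the $L^2$ (almost everywhere) sense, and infinite series as converging in $L^2$. *)

(* Defs.v *)
From HB Require Import structures.
From mathcomp Require Import all_boot all_order all_algebra.
From mathcomp Require Import all_classical all_reals all_analysis.

Set Implicit Arguments.
Unset Strict Implicit.
Unset Printing Implicit Defensive.

Import Order.TTheory GRing.Theory Num.Theory.
Import numFieldNormedType.Exports.

Local Open Scope classical_set_scope.
Local Open Scope ring_scope.

(* Coefficient functions of the continuous-stage method for q'' = f(t, q)
     Q_t = q0 + h C_t q0' + h^2 \int_0^1 Abar_{t,s} f(t0 + C_s h, Q_s) ds,
     q1  = q0 + h q0' + h^2 \int_0^1 Bbar_t f(t0 + C_t h, Q_t) dt,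
     q1' = q0' + h \int_0^1 B_t f(t0 + C_t h, Q_t) dt.
   Only their values on [0, 1] matter. *)
Record csRKN (R : realType) := CsRKN {
  Abar : R -> R -> R;
  Bbar : R -> R;
  Bcoef : R -> R;
  Ccoef : R -> R
}.

Section SimplifyingAssumptions.
Context {R : realType}.
Local Notation mu := (@lebesgue_measure R).

(* The integrals are extended-real valued: equality with a finite number
   includes the existence of the integral. *)
Definition CN (M : csRKN R) (eta : nat) : Prop :=
  forall k : nat, (1 <= k <= eta - 1)%N ->
    {ae mu, forall t : R, 0 <= t <= 1 ->
      (\int[mu]_(s in `[0%R, 1%R]) (Abar M t s * Ccoef M s ^+ (k - 1))%:E
       = (Ccoef M t ^+ (k + 1) / (k%:R * (k + 1)%:R))%:E)%E}.

Definition DN (M : csRKN R) (zeta : nat) : Prop :=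
  forall k : nat, (1 <= k <= zeta - 1)%N ->
    {ae mu, forall s : R, 0 <= s <= 1 ->
      (\int[mu]_(t in `[0%R, 1%R])
          (Bcoef M t * Ccoef M t ^+ (k - 1) * Abar M t s)%:E
       = (Bcoef M s * Ccoef M s ^+ (k + 1) / (k%:R * (k + 1)%:R)
          - Bcoef M s * Ccoef M s / k%:R + Bcoef M s / (k + 1)%:R)%:E)%E}.

End SimplifyingAssumptions.

Definition legendreP (R : realType) (i : nat) : {poly R} :=
  (Num.sqrt (2 * i%:R + 1) / (i`!)%:R) *: (('X^i * ('X - 1) ^+ i)^`(i)).

Definition xi (R : realType) (i : nat) : R :=
  1 / (2 * Num.sqrt (4 * i%:R ^+ 2 - 1)).

Section L2Square.
Context {R : realType}.
Local Notation mu2 := (@lebesgue_measure R \x @lebesgue_measure R)%E.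

Definition unit_square : set (R * R) := `[0, 1] `*` `[0, 1].

Definition L2_square (f : R * R -> R) : Prop :=
  f \_ unit_square \in Lfun mu2 2%:E.

Definition norm2_square (f : R * R -> R) : \bar R :=
  ('N[mu2]_2%:E [EFin \o (f \_ unit_square)])%E.

Definition ae_square (P : R * R -> Prop) : Prop :=
  {ae mu2, forall x, unit_square x -> P x}.

(* S is the L^2 sum of the double series of the F i j over i >= a, j >= b:
   its rectangular partial sums converge to S as both cut-offs tend to
   infinity, independently of each other. *)
Definition L2_double_sum (a b : nat) (F : nat -> nat -> R * R -> R)
    (S : R * R -> R) : Prop :=
  L2_square S /\
  (norm2_square (fun x => S x - \sum_(a <= i < mn.1) \sum_(b <= j < mn.2) F i j x)
     @[mn --> (\oo, \oo)] --> 0%E).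

End L2Square.

(* Main.v *)
(** Write K for the explicit part of the expansion and D for the difference of
    the coefficient and K.  Integrating the shifted Legendre polynomials twice
    from 0 (for CN) or from 1 (for DN) by their three-term recurrence shows that
    K already satisfies both assumptions, so these say that the sections of D
    are orthogonal to the polynomials of degree < eta - 1 in the second
    variable and of degree < zeta - 1 in the first.  By Fubini this is the
    vanishing of the Legendre coefficients of D outside i >= zeta - 1,
    j >= eta - 1, and D is the L^2 sum of its Legendre series because the
    products P_i P_j are total in L^2 of the square: an L^2-closed subspace
    containing the polynomials contains the indicators of the boxes
    x < a, y < b (limits of the polynomials (1 - y^n)^(n 2^n) after an affine
    change of variable), hence by a pi-lambda argument those of all measurable
    sets, hence everything. *)

Require Import Defs.
From HB Require Import structures.
From mathcomp Require Import all_boot all_order all_algebra.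
From mathcomp Require Import all_classical all_reals all_analysis.
From mathcomp Require Import measurable_realfun.
From mathcomp Require Import ring lra zify.

Import Order.TTheory GRing.Theory Num.Theory.
Import numFieldNormedType.Exports.

Local Open Scope classical_set_scope.
Local Open Scope ring_scope.

(** * Shifted Legendre polynomials *)

(** With B = 1 and C_t = t the two right-hand sides are integrals of one and the same kernel:
    \int_0^t (t-s) s^(k-1) ds for CN and \int_s^1 (t-s) t^(k-1) dt for DN. So both assumptions
    compare the coefficient with max(t-s, 0), in s up to degree eta-2 and in t up to degree zeta-2,
    and K is a finite piece of the Legendre expansion of that kernel. Apart from the corner terms
    (0,1) and (1,0), the coefficient at P_i(t) P_j(s) vanishes unless |i-j| is 0 or 2, because each
    integration moves the index by one. The limits N1, N2, N3 retain every coefficient with i <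
    zeta-1 or j < eta-1; the remaining ones are absorbed by omega. Transposing K only changes a sign
    [e] and exchanges N1 with N3, so one computation, [Jint_kerP], serves both assumptions. *)

Section Rodrigues.
Context {F : comNzRingType}.
Implicit Types (w : {poly F}) (n : nat).

Lemma derivn2_exp w n :
  (w ^+ n.+2)^`(2) =
    n.+2%:R * (n.+1%:R * w ^+ n * w^`() ^+ 2 + w ^+ n.+1 * w^`(2)).
Proof.
rewrite !derivnS !derivn0 deriv_exp derivMn derivM deriv_exp /=.
rewrite -[_ *+ n.+2]mulr_natl -[(_ * _ *+ n.+1)]mulr_natl; ring.
Qed.

Definition rodrigues n : {poly F} := 'X^n * ('X - 1) ^+ n.

Lemma rodriguesE n : rodrigues n = ('X * ('X - 1)) ^+ n.
Proof. by rewrite exprMn. Qed.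

(** For w = X(X-1) one has w'^2 = 4w + 1 and w'' = 2, so the second derivative of a power of w is
    again a combination of powers of w. All Legendre recurrences below come from this. *)
Lemma derivn2_rodrigues n : (rodrigues n.+2)^`(2) =
  (n.+2 * (4 * n + 6))%N%:R * rodrigues n.+1 + (n.+2 * n.+1)%N%:R * rodrigues n.
Proof.
pose w : {poly F} := 'X * ('X - 1).
have w' : w^`() = 2%:R * 'X - 1.
  by rewrite /w derivM derivX derivB derivX derivC subr0 mulr1 mul1r; ring.
have w'' : w^`(2) = 2%:R.
  by rewrite derivnS derivn1 w' derivB mulr_natl derivMn derivX derivC subr0.
rewrite !rodriguesE derivn2_exp w' w'' expr2 exprS.
set W := _ ^+ n.
rewrite !natrM !natrD; ring.
Qed.

(** The reflection about 1/2 transfers values at 0 to values at 1, see [shleg_at1]. *)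
Lemma rodrigues_comp1BX n : rodrigues n \Po (1 - 'X) = rodrigues n.
Proof.
rewrite !rodriguesE rmorphXn/= comp_polyM comp_polyB comp_polyX comp_polyC.
by congr (_ ^+ _); ring.
Qed.

Lemma derivn_comp1BX (p : {poly F}) n :
  (p \Po (1 - 'X))^`(n) = (-1) ^+ n *: (p^`(n) \Po (1 - 'X)).
Proof.
elim: n => [|n IH]; first by rewrite expr0 scale1r.
rewrite derivnS IH derivZ deriv_comp derivB derivC derivX sub0r mulrN1.
by rewrite exprS mulN1r scaleNr scalerN derivnS.
Qed.

Lemma monic_rodrigues n : rodrigues n \is monic.
Proof. by rewrite rodriguesE monic_exp// monicMl ?monicX// monicXsubC. Qed.

Lemma coef_rodrigues n : (rodrigues n)`_n = (-1) ^+ n.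
Proof.
rewrite coefXnM ltnn subnn -horner_coef0 horner_exp hornerXsubC.
by rewrite sub0r.
Qed.

Lemma size_rodrigues n : size (rodrigues n) = (2 * n).+1.
Proof.
rewrite /rodrigues mulrC size_Mmonic ?monicXn//; last first.
  by rewrite monic_neq0// monic_exp// monicXsubC.
by rewrite size_polyXn size_exp_XsubC; lia.
Qed.

End Rodrigues.

Section ShiftedLegendre.
Context {F : numFieldType}.
Implicit Types (p q : {poly F}) (i j n : nat) (c : F).

Lemma poly_eq0_deriv0 p c : p^`() = 0 -> p.[c] = 0 -> p = 0.
Proof.
move=> p'0 pc0.
have pE : p = (p`_0)%:P.
  apply/polyP => -[|k]; rewrite coefC//=.
  have /polyP/(_ k)/eqP := p'0; rewrite coef_deriv coef0 mulrn_eq0 /=.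
  by move/eqP.
by move: pc0; rewrite pE hornerC => ->.
Qed.

(* Legendre polynomials normalised by L_n(1) = 1. *)
Definition shleg n : {poly F} := (n`!)%:R^-1 *: (rodrigues n)^`(n).

Let fact_neq0 k : (k`!)%:R != 0 :> F.
Proof. by rewrite pnatr_eq0 -lt0n fact_gt0. Qed.

Lemma natD_neq0 k n : k.+1%:R + n%:R != 0 :> F.
Proof. by rewrite -natrD pnatr_eq0. Qed.

Lemma size_shleg n : size (shleg n) = n.+1.
Proof.
have fn0 : (n`!)%:R^-1 != 0 :> F by rewrite invr_eq0.
have szl : (size (shleg n) <= n.+1)%N.
  apply/leq_sizeP => k nk; rewrite coefZ coef_derivn nth_default ?mul0rn ?mulr0//.
  by rewrite size_rodrigues; lia.
apply/eqP; rewrite eqn_leq szl/= ltnNge; apply/negP => /leq_sizeP/(_ n (leqnn _)).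
rewrite coefZ coef_derivn => /eqP; rewrite mulf_eq0 (negbTE fn0)/= mulrn_eq0.
have -> : (@rodrigues F n)`_(n + n) = 1.
  have /monicP := @monic_rodrigues F n; rewrite lead_coefE size_rodrigues/=.
  by rewrite mul2n addnn.
rewrite oner_eq0 orbF; apply/negP; rewrite -lt0n ffact_gt0; lia.
Qed.

Lemma shleg0 : shleg 0%N = 1.
Proof. by rewrite /shleg fact0 invr1 scale1r /rodrigues !expr0 mulr1. Qed.

Lemma shleg1 : shleg 1%N = 2%:R * 'X - 1.
Proof.
rewrite /shleg factS fact0 invr1 scale1r /rodrigues !expr1 derivn1.
by rewrite derivM derivX derivB derivX derivC; ring.
Qed.

(** This is [derivn2_rodrigues] differentiated n+1 more times. Read backwards, it gives L_{n+1} an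
    antiderivative with only two Legendre terms, which agree at both ends of [0, 1]. *)
Lemma deriv_shleg_rec n :
  (shleg n.+2)^`() = (4 * n%:R + 6) *: shleg n.+1 + (shleg n)^`().
Proof.
have D1 k : (shleg k)^`() = (k`!)%:R^-1 *: (rodrigues k)^`(k.+1).
  by rewrite /shleg derivZ.
have -> : (shleg n.+2)^`() = (n.+2)`!%:R^-1 *: ((rodrigues n.+2)^`(2))^`(n.+1).
  by rewrite D1 /derivn -iterD addn2.
have L k : (k`!)%:R *: shleg k = (rodrigues k)^`(k) by rewrite scalerA divff ?scale1r.
rewrite derivn2_rodrigues [_%:R * rodrigues n.+1]mulr_natl [_%:R * rodrigues n]mulr_natl.
rewrite derivnD !derivnMn [in X in _ + X]derivnS -(L n.+1) -(L n) derivZ.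
rewrite -[_ *: shleg n.+1 *+ _]scaler_nat -[_ *: (shleg n)^`() *+ _]scaler_nat.
rewrite scalerDr (scalerA (n.+2 * _)%:R) (scalerA (n.+2 * n.+1)%:R) !(scalerA (n.+2)`!%:R^-1).
congr (_ *: _ + _).
  by rewrite !factS !natrM natrD natrM; field; rewrite fact_neq0 (natD_neq0 0) (natD_neq0 1).
rewrite !factS !natrM -[RHS]scale1r; congr (_ *: _).
by field; rewrite fact_neq0 (natD_neq0 0) (natD_neq0 1).
Qed.

Lemma shleg_at0 n : (shleg n).[0] = (-1) ^+ n.
Proof.
rewrite horner_coef0 coefZ coef_derivn addn0 ffactnn coef_rodrigues -(mulr_natr ((-1) ^+ n)).
by rewrite mulrCA mulVf ?mulr1.
Qed.

Lemma shleg_at1 n : (shleg n).[1] = 1.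
Proof.
have := derivn_comp1BX (@rodrigues F n) n.
rewrite rodrigues_comp1BX => /(congr1 (horner^~ 1)).
rewrite hornerZ horner_comp hornerD hornerN hornerX hornerC subrr => e.
rewrite hornerZ e.
have := shleg_at0 n; rewrite hornerZ mulrCA => ->.
by rewrite -exprMn mulrNN mulr1 expr1n.
Qed.

End ShiftedLegendre.

(** * Integration of polynomials over [0, 1]: orthogonality, repeated antiderivatives, the kernel *)

Section LegendreIntegral.
Context {R : realType}.
Implicit Types (p q : {poly R}) (i j n : nat) (c : R).
Local Notation mu := (@lebesgue_measure R).

Lemma continuous_within_horner (A : set R) p : {within A, continuous (horner p)}.
Proof. by apply: continuous_subspaceT => x; exact: continuous_horner. Qed.

Lemma integrable_horner p : mu.-integrable `[0, 1] (EFin \o horner p).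
Proof.
apply: continuous_compact_integrable; first exact: segment_compact.
exact: continuous_within_horner.
Qed.

Definition Jint p : R := \int[mu]_(x in `[0, 1]) p.[x].

Lemma integral_unit_horner p : (\int[mu]_(x in `[0%R, 1%R]) (p.[x])%:E = (Jint p)%:E)%E.
Proof.
by rewrite /Jint /Rintegral fineK//; apply: integrable_fin_num => //; exact: integrable_horner.
Qed.

Lemma JintD p q : Jint (p + q) = Jint p + Jint q.
Proof.
rewrite /Jint -RintegralD//; [|exact: integrable_horner..].
by apply: eq_Rintegral => x _; rewrite hornerD.
Qed.

Lemma JintZ c p : Jint (c *: p) = c * Jint p.
Proof.
rewrite /Jint -RintegralZl//; last exact: integrable_horner.
by apply: eq_Rintegral => x _; rewrite hornerZ.
Qed.

Lemma Jint0 : Jint 0 = 0.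
Proof. by rewrite -[0 in LHS](scale0r 0) JintZ mul0r. Qed.

Lemma JintN p : Jint (- p) = - Jint p.
Proof. by rewrite -scaleN1r JintZ mulN1r. Qed.

Lemma JintB p q : Jint (p - q) = Jint p - Jint q.
Proof. by rewrite JintD JintN. Qed.

Lemma Jint_sum (I : Type) (r : seq I) (P : pred I) (E : I -> {poly R}) :
  Jint (\sum_(k <- r | P k) E k) = \sum_(k <- r | P k) Jint (E k).
Proof. by apply: (big_morph Jint JintD Jint0). Qed.

Lemma Jint_deriv p : Jint p^`() = p.[1] - p.[0].
Proof.
rewrite /Jint /Rintegral (@continuous_FTC2 _ _ (horner p)) ?ltr01//.
- exact: continuous_within_horner.
- split=> [x _||].
  + exact: derivable_horner.
  + by apply: cvg_at_right_filter; exact: continuous_horner.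
  + by apply: cvg_at_left_filter; exact: continuous_horner.
- by move=> x _; rewrite derivE.
Qed.

Lemma JintC c : Jint c%:P = c.
Proof.
have -> : c%:P = (c *: 'X)^`() by rewrite derivZ derivX -mul_polyC mulr1.
by rewrite Jint_deriv !hornerZ !hornerX mulr1 mulr0 subr0.
Qed.

Lemma Jint_parts p q :
  Jint (p^`() * q) = p.[1] * q.[1] - p.[0] * q.[0] - Jint (p * q^`()).
Proof.
by rewrite -!hornerM -Jint_deriv -JintB derivM addrK.
Qed.

Local Notation L := (@shleg R).

(** L_{n+1} is a multiple of (L_{n+2} - L_n)', and this difference vanishes at 0 and 1. Integration
    by parts therefore has no boundary term and lowers the degree of q by one, while the index drops
    by at most one. *)
Lemma shleg_ortho_lt n q : (size q <= n)%N -> Jint (L n * q) = 0.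
Proof.
elim: {q}(size q) {-2}q (leqnn (size q)) n => [|d IH] q szq n qn.
  by move: szq; rewrite leqn0 size_poly_eq0 => /eqP ->; rewrite mulr0 Jint0.
case: n qn => [|n] qn.
  by move: qn; rewrite leqn0 size_poly_eq0 => /eqP ->; rewrite mulr0 Jint0.
have a0 : 4 * n%:R + 6 != 0 :> R.
  by rewrite gt_eqF// ltr_wpDl// mulr_ge0.
have -> : L n.+1 = (4 * n%:R + 6)^-1 *: (L n.+2 - L n)^`().
  by rewrite derivB deriv_shleg_rec addrK scalerA mulVf ?scale1r.
rewrite -scalerAl JintZ Jint_parts !hornerD !hornerN !shleg_at1 !shleg_at0 !exprS.
rewrite subrr mul0r !mulN1r opprK subrr mul0r subrr sub0r mulrBl JintB.
have [q'd q'n] : (size q^`() <= d)%N /\ (size q^`() <= n)%N.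
  have [->|q0] := eqVneq q 0; first by rewrite derivC size_poly0.
  by have := lt_size_deriv q0; split; lia.
rewrite (IH _ q'd n.+2) ?(IH _ q'd n) ?subrr ?oppr0 ?mulr0//; lia.
Qed.

(** The integral of L_{n+2}' L_{n+1} is evaluated twice. The recurrence leaves (4n+6) times the
    wanted norm, and integration by parts leaves the boundary term 1 - (-1) = 2; the other integrals
    vanish by degree. *)
Lemma shleg_norm n : Jint (L n * L n) = (2 * n%:R + 1)^-1.
Proof.
case: n => [|n].
  by rewrite shleg0 mulr1 -polyC1 JintC mulr0 add0r invr1.
have := Jint_parts (L n.+2) (L n.+1).
rewrite deriv_shleg_rec mulrDl -scalerAl JintD JintZ !shleg_at1 !shleg_at0.
have szd k m : (k <= m)%N -> (size (@shleg R k)^`() <= m)%N.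
  move=> km; have Lk0 : @shleg R k != 0 by rewrite -size_poly_eq0 size_shleg.
  by have := lt_size_deriv Lk0; rewrite size_shleg; lia.
rewrite [(L n)^`() * _]mulrC (@shleg_ortho_lt n.+1 _ (szd n n.+1 _))//.
rewrite (@shleg_ortho_lt n.+2 _ (szd n.+1 n.+2 _))// subr0 addr0.
have -> : (-1) ^+ n.+2 * (-1) ^+ n.+1 = -1 :> R.
  by rewrite exprS -mulrA -exprMn mulrNN mulr1 expr1n mulr1.
rewrite mulr1 opprK => e.
have a0 : 2 * n.+1%:R + 1 != 0 :> R by rewrite gt_eqF// ltr_wpDl// mulr_ge0.
by apply: (mulfI a0); rewrite mulfV// -natr1; lra.
Qed.

Local Notation P := (@legendreP R).

Lemma legendrePE n : P n = Num.sqrt (2 * n%:R + 1) *: L n.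
Proof. by rewrite /legendreP /shleg scalerA. Qed.

Lemma size_legendreP n : size (P n) = n.+1.
Proof.
by rewrite legendrePE size_scale ?size_shleg// gt_eqF// sqrtr_gt0.
Qed.

Lemma legendreP_ortho_lt n q : (size q <= n)%N -> Jint (P n * q) = 0.
Proof. by move=> ?; rewrite legendrePE -scalerAl JintZ shleg_ortho_lt ?mulr0. Qed.

Lemma legendreP_orthonormal i j : Jint (P i * P j) = (i == j)%:R.
Proof.
have [->|] := eqVneq i j; last first.
  rewrite neq_ltn => /orP[ij|ij]; last by rewrite legendreP_ortho_lt ?size_legendreP.
  by rewrite mulrC legendreP_ortho_lt ?size_legendreP.
rewrite !legendrePE -scalerAl -scalerAr !JintZ shleg_norm mulrA -expr2.
have a0 : 0 < 2 * j%:R + 1 :> R by rewrite ltr_wpDl// mulr_ge0.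
by rewrite sqr_sqrtr ?ltW// divff// gt_eqF.
Qed.

(** P_n has degree exactly n, so subtracting a multiple of it cancels the top coefficient of q. Any
    linear property of polynomials need only be checked on the P_j. *)
Lemma legendreP_ind n (V : {poly R} -> Prop) :
  V 0 -> (forall p q, V p -> V q -> V (p + q)) -> (forall c p, V p -> V (c *: p)) ->
  (forall j, (j < n)%N -> V (P j)) -> forall q, (size q <= n)%N -> V q.
Proof.
move=> V0 VD VZ; elim: n => [|n IH] VP q szq.
  by move: szq; rewrite leqn0 size_poly_eq0 => /eqP ->.
pose c := q`_n / (P n)`_n.
have Pn0 : (P n)`_n != 0.
  by rewrite -[n in _`_n]/(n.+1.-1) -(size_legendreP n) -lead_coefE lead_coef_eq0
    -size_poly_eq0 size_legendreP.
rewrite -(subrK (c *: P n) q); apply: VD; last exact/VZ/VP.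
apply: IH => [j jn|]; first by apply: VP; rewrite ltnS ltnW.
apply/leq_sizeP => k; rewrite leq_eqVlt coefB coefZ => /predU1P[<-|nk].
  by rewrite /c divfK ?subrr.
by rewrite !nth_default ?mulr0 ?subrr// ?size_legendreP//; exact: leq_trans nk.
Qed.

Local Notation xi := (@xi R).

(** From 4(n+1)^2 - 1 = (2n+1)(2n+3). Together with [xiSV] this gives the two terms of [antiP] the
    same factor in front of unnormalised Legendre polynomials. *)
Lemma xiS n : xi n.+1 * Num.sqrt (2 * n.+1%:R + 1) = (2 * Num.sqrt (2 * n%:R + 1))^-1.
Proof.
have a0 : 0 < 2 * n%:R + 1 :> R by rewrite ltr_wpDl// mulr_ge0.
have b0 : 0 < 2 * n.+1%:R + 1 :> R by rewrite ltr_wpDl// mulr_ge0.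
rewrite /Defs.xi (_ : 4 * _ - 1 = (2 * n%:R + 1) * (2 * n.+1%:R + 1)).
  rewrite sqrtrM ?ltW//; field.
  by rewrite !gt_eqF// sqrtr_gt0.
by rewrite -!natr1; ring.
Qed.

Lemma xiSV n : xi n.+1 * Num.sqrt (2 * n%:R + 1) = (2 * Num.sqrt (2 * n.+1%:R + 1))^-1.
Proof.
have a0 : 0 < 2 * n%:R + 1 :> R by rewrite ltr_wpDl// mulr_ge0.
have b0 : 0 < 2 * n.+1%:R + 1 :> R by rewrite ltr_wpDl// mulr_ge0.
rewrite /Defs.xi (_ : 4 * _ - 1 = (2 * n%:R + 1) * (2 * n.+1%:R + 1)).
  rewrite sqrtrM ?ltW//; field.
  by rewrite !gt_eqF// sqrtr_gt0.
by rewrite -!natr1; ring.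
Qed.

Lemma xi_legendreP n : xi n.+1 *: P n.+1 = (2 * Num.sqrt (2 * n%:R + 1))^-1 *: L n.+1.
Proof. by rewrite legendrePE scalerA xiS. Qed.

Lemma xi_legendrePV n : xi n.+1 *: P n = (2 * Num.sqrt (2 * n.+1%:R + 1))^-1 *: L n.
Proof. by rewrite legendrePE scalerA xiSV. Qed.

(* An antiderivative of P_j; for [j > 0] it vanishes at both ends of [0, 1], for
   [j = 0] at 0 if [e = 1] and at 1 if [e = -1]. *)
Definition antiP (e : R) j : {poly R} :=
  if j is n.+1 then xi n.+2 *: P n.+2 - xi n.+1 *: P n
  else xi 1 *: P 1 + (e / 2)%:P.

Lemma deriv_antiP e j : (antiP e j)^`() = P j.
Proof.
case: j => [|n]; rewrite /antiP.
  rewrite derivD derivC addr0 xi_legendreP legendrePE mulr0 add0r sqrtr1 mulr1.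
  rewrite shleg0 shleg1 scale1r derivZ derivB mulr_natl derivMn derivX derivC subr0.
  by rewrite -scalerMnr scalerMnl -[RHS]scale1r; congr (_ *: _); field.
rewrite xi_legendreP xi_legendrePV -scalerBr derivZ derivB deriv_shleg_rec addrK.
rewrite scalerA legendrePE; congr (_ *: _).
have b0 : 0 < 2 * n.+1%:R + 1 :> R by rewrite ltr_wpDl// mulr_ge0.
apply: (@mulIf _ (2 * Num.sqrt (2 * n.+1%:R + 1))).
  by rewrite mulf_neq0// gt_eqF// sqrtr_gt0.
rewrite mulrAC mulVf ?mul1r; last by rewrite mulf_neq0// gt_eqF// sqrtr_gt0.
by rewrite mulrCA -expr2 sqr_sqrtr ?ltW// -natr1; ring.
Qed.

(** The sign encodes the base point: e = 1 is c = 0 and e = -1 is c = 1. For j > 0 the two Legendre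
    terms cancel there; for j = 0 the constant e/2 compensates the end value of P_1. *)
Lemma antiP_end e c j : e ^+ 2 = 1 -> c = (1 - e) / 2 -> (antiP e j).[c] = 0.
Proof.
move=> e2 ->; have /orP[/eqP ->|/eqP ->] : (e == 1) || (e == -1) by rewrite -sqrf_eq1 e2.
- rewrite subrr mul0r; case: j => [|n]; rewrite /antiP.
    rewrite xi_legendreP mulr0 add0r sqrtr1 mulr1 hornerD hornerC hornerZ shleg_at0.
    by field.
  rewrite xi_legendreP xi_legendrePV -scalerBr hornerZ hornerD hornerN !shleg_at0.
  by rewrite !exprS; ring.
- rewrite opprK -[1 + 1]/(2%:R) divff//; case: j => [|n]; rewrite /antiP.
    rewrite xi_legendreP mulr0 add0r sqrtr1 mulr1 hornerD hornerC hornerZ shleg_at1.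
    by field.
  by rewrite xi_legendreP xi_legendrePV -scalerBr hornerZ hornerD hornerN !shleg_at1 subrr mulr0.
Qed.

(** The right-hand sides of CN and DN, up to the factor B = 1, are these antiderivatives of the
    monomial of degree k-1, with c = 0 and c = 1 respectively. *)
Definition second_antideriv c q p := [/\ p^`(2) = q, p.[c] = 0 & p^`().[c] = 0].

Lemma second_antiderivD c q1 q2 p1 p2 : second_antideriv c q1 p1 ->
  second_antideriv c q2 p2 -> second_antideriv c (q1 + q2) (p1 + p2).
Proof.
move=> [e1 z1 d1] [e2 z2 d2]; split; first by rewrite derivnD e1 e2.
- by rewrite hornerD z1 z2 addr0.
- by rewrite derivD hornerD d1 d2 addr0.
Qed.

Lemma second_antiderivZ c a q p : second_antideriv c q p ->
  second_antideriv c (a *: q) (a *: p).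
Proof.
move=> [e z d]; split; first by rewrite derivnZ e.
- by rewrite hornerZ z mulr0.
- by rewrite derivZ hornerZ d mulr0.
Qed.

Lemma second_antideriv_uniq c q p1 p2 :
  second_antideriv c q p1 -> second_antideriv c q p2 -> p1 = p2.
Proof.
move=> [e1 z1 d1] [e2 z2 d2]; apply/eqP; rewrite -subr_eq0; apply/eqP.
apply: (@poly_eq0_deriv0 _ _ c); last by rewrite hornerD hornerN z1 z2 subrr.
apply: (@poly_eq0_deriv0 _ _ c); last by rewrite derivB hornerD hornerN d1 d2 subrr.
by rewrite derivB derivB; move: e1 e2; rewrite !derivnS !derivn0 => -> ->; rewrite subrr.
Qed.

(** Integrating [antiP e j] once more replaces each P_k in it by [antiP e k]; its constant e/2
    counts as (e/2) P_0. *)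
Lemma second_antideriv_legendreP e c j : e ^+ 2 = 1 -> c = (1 - e) / 2 ->
  second_antideriv c (P j)
    (if j is n.+1 then xi n.+2 *: antiP e n.+2 - xi n.+1 *: antiP e n
     else xi 1 *: antiP e 1 + (e / 2) *: antiP e 0).
Proof.
move=> e2 ce.
have D : (if j is n.+1 then xi n.+2 *: antiP e n.+2 - xi n.+1 *: antiP e n
     else xi 1 *: antiP e 1 + (e / 2) *: antiP e 0)^`() = antiP e j.
  case: j => [|n]; last by rewrite derivB !derivZ !deriv_antiP.
  rewrite derivD !derivZ !deriv_antiP /antiP (legendrePE 0).
  by rewrite mulr0 add0r sqrtr1 scale1r shleg0 -alg_polyC.
split; first by rewrite !derivnS derivn0 D deriv_antiP.
- by case: j {D} => [|n]; rewrite hornerD ?hornerN !hornerZ !antiP_end// !mulr0 ?subr0 ?addr0.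
- by rewrite D antiP_end.
Qed.

(* The explicit part of the expansion as a polynomial in s, for fixed t;
   [e = 1] gives the kernel itself, [e = -1] with N1 and N3 exchanged its transpose. *)
Definition kerP (e : R) (N1 N2 N3 : nat) (t : R) : {poly R} :=
  (1 / 6)%:P - (e / 2 * xi 1) *: P 1 + (e / 2 * xi 1 * (P 1).[t])%:P
  + \sum_(1 <= i < N1.+1) (xi i * xi i.+1 * (P i.-1).[t]) *: P i.+1
  - \sum_(1 <= i < N2.+1) ((xi i ^+ 2 + xi i.+1 ^+ 2) * (P i).[t]) *: P i
  + \sum_(1 <= i < N3.+1) (xi i * xi i.+1 * (P i.+1).[t]) *: P i.-1.

(** [k] is the only index whose term can pair with P_j. The condition is restricted to i >= 1
    because [predn] identifies 0 and 1. *)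
Lemma Jint_legendreP_sum (N : nat) (G : nat -> R) (f : nat -> nat) j k :
  (forall i, (1 <= i < N.+1)%N -> (f i == j) = (i == k)) ->
  Jint ((\sum_(1 <= i < N.+1) G i *: P (f i)) * P j) =
    if (1 <= k <= N)%N then G k else 0.
Proof.
move=> fk; rewrite mulr_suml Jint_sum.
rewrite (eq_big_nat _ _ (F2 := fun i => if i == k then G i else 0)); last first.
  move=> i iN; rewrite -scalerAl JintZ legendreP_orthonormal fk//.
  by case: (i == k); rewrite ?mulr1 ?mulr0.
case: ifPn => kN.
  rewrite (bigD1_seq k) ?iota_uniq//= ?eqxx; last by rewrite mem_index_iota ltnS.
  by rewrite big1 ?addr0// => i /negbTE ->.
rewrite big_nat big1// => i iN; case: eqP => // ik.
by move: iN kN; rewrite ik ltnS => ->.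
Qed.

Lemma legendreP0 : P 0%N = 1.
Proof. by rewrite legendrePE mulr0 add0r sqrtr1 scale1r shleg0. Qed.

(** P_j meets the three sums at the indices j-1, j and j+1, which for j < m lie within the stated
    bounds. Longer sums only add terms orthogonal to P_j. *)
Lemma Jint_kerP (e c : R) N1 N2 N3 m q p t :
  e ^+ 2 = 1 -> c = (1 - e) / 2 ->
  (m - 2 <= N1)%N -> (m - 1 <= N2)%N -> (m <= N3)%N ->
  (size q <= m)%N -> second_antideriv c q p -> Jint (kerP e N1 N2 N3 t * q) = p.[t].
Proof.
move=> e2 ce mN1 mN2 mN3 szq qp.
(* With p quantified existentially the claim is linear in q, so [legendreP_ind] applies; uniqueness
   then identifies p' with p. *)
suff [p' [qp' ->]] : exists p', second_antideriv c q p' /\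
    Jint (kerP e N1 N2 N3 t * q) = p'.[t].
  by rewrite (second_antideriv_uniq _ _ _ _ qp qp').
move: q szq {p qp}; apply: (@legendreP_ind m).
- exists 0; split; last by rewrite mulr0 Jint0 horner0.
  by split; rewrite ?derivnC ?derivC ?horner0.
- move=> q1 q2 [p1 [s1 j1]] [p2 [s2 j2]]; exists (p1 + p2); split.
    exact: second_antiderivD.
  by rewrite mulrDr JintD j1 j2 hornerD.
- move=> a q [p [s j]]; exists (a *: p); split; first exact: second_antiderivZ.
  by rewrite -scalerAr JintZ j hornerZ.
move=> j jm; eexists; split; first exact: (@second_antideriv_legendreP e).
have JC a : Jint (a%:P * P j) = a * (0%N == j)%:R.
  by rewrite mul_polyC JintZ -legendreP_orthonormal legendreP0 mul1r.
have J1 a : Jint (a *: P 1 * P j) = a * (1%N == j)%:R.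
  by rewrite -scalerAl JintZ legendreP_orthonormal.
rewrite /kerP !(mulrDl, mulNr) !(JintD, JintN) !(JC, J1).
rewrite (@Jint_legendreP_sum N1 _ S j j.-1); last by move=> [|i]; lia.
rewrite (@Jint_legendreP_sum N2 _ id j j); last by [].
rewrite (@Jint_legendreP_sum N3 _ predn j j.+1); last by move=> [|i]; lia.
have -> : (1 <= j.+1 <= N3)%N by lia.
have -> : (1 <= j <= N2)%N = (0 < j)%N by lia.
have -> : (1 <= j.-1 <= N1)%N = (1 < j)%N by lia.
have xi1 : xi 1 ^+ 2 = 12^-1.
  rewrite /Defs.xi expr_div_n expr1n exprMn ?expr1n ?mulr1.
  by rewrite sqr_sqrtr; [field|rewrite subr_ge0; lra].
rewrite /antiP; move: xi1 legendreP0 {JC J1}.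
move: (@Defs.xi R) (@legendreP R) => x f xi1 f0.
case: j jm => [|[|j]] jm /=;
  rewrite !(hornerD, hornerN, hornerZ, hornerC) ?f0 ?hornerC ?eqxx ?mulr1n ?mulr0n.
(* Origin of the constant 1/6: integrating P_0 twice leaves the constant 1/4 - xi_1^2 = 1/4 -
   1/12. *)
- have -> : 1 / 6 = e ^+ 2 / 4 - x 1%N ^+ 2 :> R by rewrite e2 xi1; field.
  by field.
- by ring.
- by ring.
Qed.

End LegendreIntegral.

(** * The inner product of L^2 *)

Section InnerProduct.
Context d (T : measurableType d) (R : realType) (mu : {measure set T -> \bar R}).
Implicit Types (f g h : T -> R) (a : R).
Local Notation L2 := (Lfun mu 2%:E).

Let le12 : (1 <= 2%:E :> \bar R)%E. Proof. by rewrite lee_fin ler1n. Qed.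

Lemma L2_measurable f : f \in L2 -> measurable_fun setT f.
Proof. by move=> /sub_Lfun_mfun; rewrite inE. Qed.

Lemma eq_L2 f g : f =1 g -> g \in L2 -> f \in L2.
Proof. by move=> /funext ->. Qed.

Lemma L2P f : measurable_fun setT f -> (\int[mu]_x (f x ^+ 2)%:E < +oo)%E -> f \in L2.
Proof.
move=> mf fi; rewrite inE; apply/andP; split; rewrite inE//=.
rewrite /finite_norm unlock poweR_lty//.
by under eq_integral do rewrite /= powR_mulrn// real_normK ?num_real//.
Qed.

Lemma L2_dominated f g : measurable_fun setT f -> g \in L2 ->
  (forall x, `|f x| <= `|g x|) -> f \in L2.
Proof.
move=> mf g2 fg; apply: L2P => //.
have /integrableP[_] := Lfun2_integrable_sqr g2.
apply: le_lt_trans; apply: ge0_le_integral => //.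
- by move=> x _; rewrite lee_fin sqr_ge0.
- by apply/measurable_EFinP; exact: measurable_funX.
- by apply: measurableT_comp => //; apply/measurable_EFinP; apply: measurable_funX; exact: L2_measurable.
- move=> x _; rewrite /= lee_fin ger0_norm ?sqr_ge0//.
  by rewrite -(real_normK (num_real (f x))) -(real_normK (num_real (g x))) lerXn2r// nnegrE.
Qed.

Lemma L20 : (fun=> 0 : R) \in L2.
Proof.
apply: L2P; first exact: measurable_cst.
by under eq_integral do rewrite expr0n/=; rewrite integral0.
Qed.

Lemma L2D f g : f \in L2 -> g \in L2 -> (fun x => f x + g x) \in L2.
Proof. by move=> f2 g2; have [_ h] := @Lfun_addr_closed _ _ _ mu _ le12; exact: h. Qed.

Lemma L2Z a f : f \in L2 -> (fun x => a * f x) \in L2.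
Proof.
move=> f2; apply: eq_L2 (@Lfun_scale _ _ _ mu f a 2 (ler1n _ 2) f2) => x.
by rewrite mulrC.
Qed.

Lemma L2B f g : f \in L2 -> g \in L2 -> (fun x => f x - g x) \in L2.
Proof.
move=> f2 g2; apply: eq_L2 (L2D _ _ f2 (L2Z (-1) _ g2)) => x.
by rewrite mulN1r.
Qed.

Lemma L2_sum (I : Type) (r : seq I) (F : I -> T -> R) :
  (forall i, F i \in L2) -> (fun x => \sum_(i <- r) F i x) \in L2.
Proof.
move=> F2; elim: r => [|i r IH].
  by apply: eq_L2 L20 => x; rewrite big_nil.
by apply: eq_L2 (L2D _ _ (F2 i) IH) => x; rewrite big_cons.
Qed.

Definition inner f g : R := \int[mu]_x (f x * g x).
Local Notation ip := inner.

Lemma ip_integrable f g : f \in L2 -> g \in L2 ->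
  mu.-integrable setT (EFin \o (fun x => f x * g x)).
Proof. by move=> f2 g2; apply/Lfun1_integrable; exact: Lfun2_mul_Lfun1. Qed.

Lemma integral_ip f g : f \in L2 -> g \in L2 ->
  (\int[mu]_x (f x * g x)%:E = (ip f g)%:E)%E.
Proof.
move=> f2 g2; rewrite /ip /Rintegral fineK//.
by apply: integrable_fin_num => //; exact: ip_integrable.
Qed.

Lemma ipC f g : ip f g = ip g f.
Proof. by apply: eq_Rintegral => x _; rewrite mulrC. Qed.

Lemma ipDl f g h : f \in L2 -> g \in L2 -> h \in L2 ->
  ip (fun x => f x + g x) h = ip f h + ip g h.
Proof.
move=> f2 g2 h2; rewrite /ip -RintegralD//; [|exact: ip_integrable..].
by apply: eq_Rintegral => x _; rewrite mulrDl.
Qed.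

Lemma ipZl a f h : f \in L2 -> h \in L2 -> ip (fun x => a * f x) h = a * ip f h.
Proof.
move=> f2 h2; rewrite /ip -RintegralZl//; last exact: ip_integrable.
by apply: eq_Rintegral => x _; rewrite mulrA.
Qed.

Lemma ipBl f g h : f \in L2 -> g \in L2 -> h \in L2 ->
  ip (fun x => f x - g x) h = ip f h - ip g h.
Proof.
move=> f2 g2 h2; rewrite -mulN1r -ipZl// -ipDl//; last exact: L2Z.
by congr ip; apply/funext => x; rewrite mulN1r.
Qed.

Lemma ip0l h : ip (fun=> 0) h = 0.
Proof. by rewrite /ip /Rintegral; under eq_integral do rewrite mul0r; rewrite integral0. Qed.

Lemma ip_suml (I : Type) (r : seq I) (F : I -> T -> R) h :
  (forall i, F i \in L2) -> h \in L2 ->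
  ip (fun x => \sum_(i <- r) F i x) h = \sum_(i <- r) ip (F i) h.
Proof.
move=> F2 h2; elim: r => [|i r IH].
  rewrite big_nil -[RHS](ip0l h); congr ip.
  by apply/funext => x; rewrite big_nil.
rewrite big_cons -IH -ipDl//; last exact: L2_sum.
by congr ip; apply/funext => x; rewrite big_cons.
Qed.

Lemma ip_ge0 f : 0 <= ip f f.
Proof. by apply: Rintegral_ge0 => x _; rewrite -expr2 sqr_ge0. Qed.

Lemma Lnorm2E f : f \in L2 -> ('N[mu]_2%:E[EFin \o f] = (Num.sqrt (ip f f))%:E)%E.
Proof.
move=> f2; rewrite unlock.
under eq_integral do rewrite /= powR_mulrn// real_normK ?num_real// expr2.
by rewrite integral_ip// poweR_EFin powR12_sqrt// ip_ge0.
Qed.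

(** A substitute for the triangle inequality that stays with squared norms. *)
Lemma ip_subD f g : f \in L2 -> g \in L2 ->
  ip (fun x => f x + g x) (fun x => f x + g x) <= 2 * (ip f f + ip g g).
Proof.
move=> f2 g2; have := ip_ge0 (fun x => f x - g x).
have ? := L2D _ _ f2 g2; have ? := L2B _ _ f2 g2.
rewrite ipBl// ipDl// ![ip _ (fun x => f x - _)]ipC ![ip _ (fun x => f x + _)]ipC.
rewrite !ipBl// !ipDl// (ipC g f); lra.
Qed.

Lemma ip_CS f g : f \in L2 -> g \in L2 -> ip f g ^+ 2 <= ip f f * ip g g.
Proof.
move=> f2 g2.
have H a : 0 <= ip f f - 2 * a * ip f g + a ^+ 2 * ip g g.
  have := ip_ge0 (fun x => f x - a * g x).
  have ? := L2Z a _ g2; have ? := L2B _ _ f2 (L2Z a _ g2).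
  rewrite ipBl// ipZl// ![ip _ (fun x => f x - _)]ipC !ipBl// !ipZl//.
  by rewrite (ipC g f) -/(is_true _); congr (_ <= _); ring.
have := ip_ge0 g; rewrite le_eqVlt => /predU1P[g0|g0].
  (* If g has norm zero, the quadratic in a is affine; were (f, g) nonzero, this a would give it the
     value -1. *)
  rewrite -g0 mulr0; apply: contraTT (H ((ip f f + 1) / (2 * ip f g))).
  rewrite -ltNge -g0 mulr0 addr0 -ltNge exprn_even_gt0//= => fg0.
  by rewrite (_ : _ - _ = -1) ?oppr_lt0 ?ltr01//; field.
have := H (ip f g / ip g g); rewrite -(ler_pM2r g0) mul0r => /le_trans; move=> h.
rewrite -subr_ge0; apply: h; rewrite le_eqVlt; apply/orP; left; apply/eqP.
by field; rewrite gt_eqF.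
Qed.

(** Dominated convergence applied to |f - f_n|^2, with majorant (2g)^2. *)
Lemma L2_dominated_cvg (f_ : nat -> T -> R) f g :
  (forall n, measurable_fun setT (f_ n)) -> g \in L2 ->
  (forall n x, `|f_ n x| <= g x) -> (forall x, f_ n x @[n --> \oo] --> f x) ->
  f \in L2 /\
  ip (fun x => f x - f_ n x) (fun x => f x - f_ n x) @[n --> \oo] --> 0.
Proof.
move=> mf_ g2 f_g f_f.
have mf : measurable_fun setT f.
  by apply: (measurable_fun_cvg mf_) => x _; exact: f_f.
have fg x : `|f x| <= g x.
  have /cvg_norm := f_f x => h; rewrite -(cvg_lim _ h)//.
  by apply: limr_le; [apply/cvg_ex; eexists; exact: h|exact: nearW].
have f2 := L2_dominated _ _ mf g2 (fun x => le_trans (fg x) (ler_norm _)).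
have f_2 n := L2_dominated _ _ (mf_ n) g2 (fun x => le_trans (f_g n x) (ler_norm _)).
split=> //.
have m2 n : measurable_fun setT (fun x => (f x - f_ n x) ^+ 2).
  by apply: measurable_funX; exact: measurable_funB.
have [] := @dominated_convergence _ T R mu setT measurableT
  (fun n x => ((f x - f_ n x) ^+ 2)%:E) (cst 0%E) (fun x => (4 * g x ^+ 2)%:E).
- by move=> n; apply/measurable_EFinP.
- by [].
- apply/nearW => x _; apply/fine_cvgP; split; first exact: nearW.
  rewrite [X in _ --> X](_ : _ = (f x - f x) * (f x - f x)); last by rewrite subrr mul0r.
  under eq_fun do rewrite /= expr2.
  by apply: cvgM; apply: cvgB => //; exact: cvg_cst.
- have /= := integrableZl measurableT 4 (Lfun2_integrable_sqr g2).
  by under eq_fun do rewrite -EFinM.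
- apply/nearW => x n _; rewrite /= lee_fin ger0_norm ?sqr_ge0//.
  rewrite -(real_normK (num_real (_ - _))) (_ : 4 * _ = (2 * g x) ^+ 2); last by ring.
  rewrite lerXn2r ?nnegrE//; first by rewrite mulr_ge0// (le_trans _ (fg x)).
  by rewrite (le_trans (ler_normB _ _))// mulr2n mulrDl mul1r lerD.
move=> _ _; rewrite integral0 => /fine_cvg; apply: cvg_trans.
by apply: near_eq_cvg; apply: nearW => n; rewrite /ip /Rintegral.
Qed.

Definition fourier_sum (I : Type) (e : I -> T -> R) (r : seq I) f : T -> R :=
  fun x => \sum_(i <- r) ip f (e i) * e i x.

(** Pythagoras: the residual is orthogonal to the projection q, so its squared norm is (f, f) - (q,
    q). *)
Lemma ip_fourier_le (I : eqType) (e : I -> T -> R) (r : seq I) f :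
  (forall i, e i \in L2) -> (forall i j, ip (e i) (e j) = (i == j)%:R) -> uniq r ->
  f \in L2 ->
  ip (fun x => f x - fourier_sum I e r f x) (fun x => f x - fourier_sum I e r f x) <= ip f f.
Proof.
move=> e2 eo ur f2; set q := fourier_sum I e r f.
have ce2 i : (fun x => ip f (e i) * e i x) \in L2 by exact: L2Z.
have q2 : q \in L2 by exact: L2_sum.
have qh h : h \in L2 -> ip q h = \sum_(i <- r) ip f (e i) * ip (e i) h.
  by move=> h2; rewrite /q /fourier_sum ip_suml//; apply: eq_bigr => i _; rewrite ipZl.
have qe j : j \in r -> ip q (e j) = ip f (e j).
  move=> jr; rewrite qh// (bigD1_seq j)//= eo eqxx mulr1.
  by rewrite big1 ?addr0// => i /negbTE ij; rewrite eo ij mulr0.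
have qq : ip q q = ip f q.
  rewrite (ipC f) !qh// !big_seq; apply: eq_bigr => i ir.
  by rewrite (ipC _ q) qe// (ipC (e i)).
have ? := L2B _ _ f2 q2.
rewrite ipBl// ![ip _ (fun x => f x - _)]ipC !ipBl// [ip q f]ipC qq subrr subr0.
by rewrite lerBlDr lerDl -qq ip_ge0.
Qed.

End InnerProduct.

(** * Totality in L^2 *)

Section L2Induction.
Context d (T : measurableType d) (R : realType) (mu : {measure set T -> \bar R}).
Implicit Types (f g h : T -> R) (a : R).
Local Notation L2 := (Lfun mu 2%:E).

(** Closedness is asked only for dominated pointwise limits, the form in which limits of indicators
    and of simple functions occur. *)
Definition L2_monotone_class (V : (T -> R) -> Prop) : Prop :=
  [/\ V (fun=> 0),
      forall a f g, V f -> V g -> V (fun x => a * f x + g x) &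
      forall (f_ : nat -> T -> R) f g, (forall n, V (f_ n)) -> g \in L2 ->
        (forall n x, `|f_ n x| <= g x) -> (forall x, f_ n x @[n --> \oo] --> f x) ->
        V f].

Context (V : (T -> R) -> Prop) (VV : L2_monotone_class V).
Context (E : set T) (mE : measurable E) (VE : V \1_E) (E2 : (\1_E : T -> R) \in L2).

Let V0 : V (fun=> 0). Proof. by case: VV. Qed.
Let VDZ : forall a f g, V f -> V g -> V (fun x => a * f x + g x).
Proof. by case: VV. Qed.
Let Vcvg : forall (f_ : nat -> T -> R) f g, (forall n, V (f_ n)) -> g \in L2 ->
  (forall n x, `|f_ n x| <= g x) -> (forall x, f_ n x @[n --> \oo] --> f x) -> V f.
Proof. by case: VV. Qed.

Let Vsum (I : Type) (r : seq I) (c : I -> R) (F : I -> T -> R) :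
  (forall i, V (F i)) -> V (fun x => \sum_(i <- r) c i * F i x).
Proof.
move=> VF; elim: r => [|i r IH].
  by under eq_fun do rewrite big_nil.
by under eq_fun do rewrite big_cons; exact: VDZ.
Qed.

(** The sets A in question form a Dynkin system: complements are taken relative to E, and disjoint
    unions are limits dominated by 1_E. Taking [phi] a projection lets one coordinate vary while E
    fixes the other. *)
Lemma monotone_class_indic d' (T' : measurableType d') (phi : T -> T')
    (G : set (set T')) :
  @measurable _ T' = <<s G >> -> setI_closed G ->
  (forall A, G A -> V \1_(phi @^-1` A `&` E)) ->
  forall A, measurable A -> V \1_(phi @^-1` A `&` E).
Proof.
move=> mG GI VG A; rewrite mG; move: A.
apply: (@dynkin_induction _ _ _ _ mG GI) => //.
- by rewrite preimage_setT setTI.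
- move=> A mA VA; have := VDZ (-1) _ _ VA VE.
  rewrite (_ : (fun x => _) = \1_(phi @^-1` (~` A) `&` E))//.
  apply/funext => x; rewrite !indicE !in_setI preimage_setC in_setC.
  by case: (x \in phi @^-1` A); case: (x \in E); rewrite /=; lra.
move=> F mF tF VF.
pose f_ n x : R := \sum_(k <- iota 0 n) 1 * \1_(phi @^-1` F k `&` E) x.
have f_E n x : f_ n x = if `[< E x /\ exists2 k, (k < n)%N & F k (phi x) >] then 1 else 0.
  rewrite /f_; case: asboolP => [[Ex [k kn Fk]]|nF].
    rewrite (bigD1_seq k) ?iota_uniq ?mem_iota//= mul1r indicE mem_set// big1 ?addr0//.
    move=> i /eqP ik; rewrite mul1r indicE memNset//= => -[Fi _]; apply: ik.
    by apply: (tF i k) => //; exists (phi x).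
  rewrite big_seq big1// => i; rewrite mem_iota/= add0n => i_n.
  by rewrite mul1r indicE memNset//= => -[Fi Ex]; apply: nF; split=> //; exists i.
apply: (Vcvg f_ _ \1_E) => // [n|n x|x].
- by apply: Vsum => k; exact: VF.
- rewrite f_E indicE; case: asboolP => [[Ex _]|_]; last by rewrite normr0.
  by rewrite mem_set// normr1.
rewrite indicE; case: (boolP (x \in _)) => [|/negP]; rewrite in_setE.
  move=> [[k _ Fk] Ex]; apply: cvg_near_cst; near=> n; rewrite f_E.
  by case: asboolP => // -[]; split=> //; exists k => //; near: n; exact: nbhs_infty_gt.
move=> nF; rewrite (_ : f_^~ x = cst 0); first exact: cvg_cst.
apply/funext => n; rewrite f_E; case: asboolP => // -[Ex [k _ Fk]]; exfalso.
by apply: nF; split=> //; exists k.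
Unshelve. all: by end_near. Qed.

Import HBNNSimple.

Lemma L2_induction : (forall A, measurable A -> V \1_(A `&` E)) ->
  forall f, f \in L2 -> (forall x, ~ E x -> f x = 0) -> V f.
Proof.
move=> VI.
have Vpos f : f \in L2 -> (forall x, ~ E x -> f x = 0) -> (forall x, 0 <= f x) -> V f.
  move=> f2 fE f0.
  have mf : measurable_fun setT (EFin \o f) by apply/measurable_EFinP; exact: L2_measurable f2.
  pose h := nnsfun_approx measurableT mf.
  have hf x : EFin \o h^~ x @ \oo --> (f x)%:E.
    by apply: cvg_nnsfun_approx => // y _; rewrite lee_fin.
  have hf' x : h n x @[n --> \oo] --> f x by have /fine_cvg := hf x.
  have hle n x : h n x <= f x.
    rewrite -(cvg_lim _ (hf' x))//; apply: (nondecreasing_cvgn_le _ _ n).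
      by move=> a b ab; exact/lefP/nd_nnsfun_approx.
    by apply/cvg_ex; eexists; exact: hf'.
  (* The factor 1_E leaves the limit unchanged, as f vanishes off E, and turns level sets into sets
     of the form A & E. *)
  apply: (Vcvg (fun n x => h n x * \1_E x) _ f) => //.
  - move=> n.
    rewrite (_ : (fun x => _) = (fun x => \sum_(y <- finmap.enum_fset (fset_set (range (h n))))
        y * \1_(h n @^-1` [set y] `&` E) x)); first by apply: Vsum => y; apply: VI; exact: measurable_sfunP.
    apply/funext => x; rewrite fimfunE fsbig_finite//= mulr_suml.
    by apply: eq_bigr => y _; rewrite -mulrA indicI.
  - move=> n x; rewrite indicE; case: (boolP (x \in E)) => _; last by rewrite mulr0 normr0.
    by rewrite mulr1 ger0_norm.
  - move=> x; rewrite indicE; case: (boolP (x \in E)) => [|/negP]; rewrite in_setE => Ex.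
      by under eq_fun do rewrite mulr1; exact: hf'.
    by under eq_fun do rewrite mulr0; rewrite fE//; exact: cvg_cst.
move=> f f2 fE.
have mf := L2_measurable _ _ _ _ _ f2.
pose fp : T -> R := f^\+; pose fn : T -> R := f^\-.
have fE' : f = fun x => -1 * fn x + fp x.
  apply/funext => x; rewrite /fn /fp /funrpos /funrneg.
  by case: leP => ?; case: leP => ?; lra.
have fn2 : fn \in L2.
  apply: (@L2_dominated _ _ _ _ _ f) => // [|x]; first exact: measurable_funrneg.
  by rewrite /fn /funrneg; case: (leP (- f x) 0) => _; rewrite ?normr0 ?normrN.
have fp2 : fp \in L2.
  apply: (@L2_dominated _ _ _ _ _ f) => // [|x]; first exact: measurable_funrpos.
  by rewrite /fp /funrpos; case: (leP (f x) 0) => _; rewrite ?normr0.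
rewrite fE'; apply: VDZ; apply: Vpos => // x.
- by move=> Ex; rewrite /fn /funrneg fE// oppr0 maxxx.
- by rewrite /fn /funrneg le_max lexx orbT.
- by move=> Ex; rewrite /fp /funrpos fE// maxxx.
- by rewrite /fp /funrpos le_max lexx orbT.
Qed.

End L2Induction.

(** * Polynomials converging to indicators of rays *)

Section StepPolynomials.
Context {R : realType}.
Implicit Types (x y z r a t : R) (n k : nat).

Lemma bernoulli_ineq t k : -1 <= t -> 1 + k%:R * t <= (1 + t) ^+ k.
Proof.
move=> t1; elim: k => [|k IH]; first by rewrite mul0r addr0 expr0.
rewrite exprS; apply: (@le_trans _ _ ((1 + t) * (1 + k%:R * t))).
  rewrite -natr1; have : 0 <= k%:R * t ^+ 2 by rewrite mulr_ge0// sqr_ge0.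
  nra.
by rewrite ler_wpM2l//; lra.
Qed.

(** With r = sqrt z, the geometric sum gives (1-r) n r^n <= 1 - r^n, so n r^n is bounded and n z^n =
    (n r^n) r^n tends to 0. *)
Lemma cvg_natM_expr z : 0 <= z < 1 -> n%:R * z ^+ n @[n --> \oo] --> 0.
Proof.
move=> /andP[z0 z1]; pose r := Num.sqrt z.
have r0 : 0 <= r by exact: sqrtr_ge0.
have r1 : r < 1 by rewrite -sqrtr1 ltr_sqrt.
have rn n : (1 - r) * (n%:R * r ^+ n) <= 1 - r ^+ n.
  elim: n => [|n IH]; first by rewrite mul0r mulr0 expr0 subrr.
  have : r * ((1 - r) * (n%:R * r ^+ n)) <= r * (1 - r ^+ n) by rewrite ler_wpM2l.
  have : 0 <= r ^+ n.+1 <= 1 by rewrite exprn_ge0//= exprn_ile1// ltW.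
  rewrite -natr1 !exprS; set u := r ^+ n; move=> /andP[h1 h2] h3.
  have : 0 <= (1 - r) * (1 - r * u) by rewrite mulr_ge0//; lra.
  nra.
apply: (@squeeze_cvgr _ _ _ _ (cst 0) (fun n => (1 - r)^-1 * r ^+ n)).
- apply: nearW => n; rewrite mulr_ge0 ?exprn_ge0//=.
  rewrite -{1}(sqr_sqrtr z0) -/r exprAC expr2 mulrA ler_wpM2r ?exprn_ge0//.
  rewrite -[leRHS]mulr1 ler_pdivlMl ?subr_gt0// (le_trans (rn n))//.
  by rewrite lerBlDr lerDl exprn_ge0.
- exact: cvg_cst.
- rewrite -[X in _ --> X](mulr0 (1 - r)^-1); apply: cvgMr.
  by apply: cvg_expr; rewrite ger0_norm.
Qed.

(** Exponent times y^n equals n (2y)^n, which tends to 0 for y < 1/2 and to infinity for y >= 1/2.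
    The extra factor n settles y = 1/2, so the limit is an exact indicator everywhere on [0, 1]. *)
Definition step_seq y n : R := (1 - y ^+ n) ^+ (n * 2 ^ n).

Lemma step_seq_itv y n : 0 <= y <= 1 -> 0 <= step_seq y n <= 1.
Proof.
move=> /andP[y0 y1]; have : 0 <= y ^+ n <= 1 by rewrite exprn_ge0//= exprn_ile1.
by move=> /andP[h0 h1]; rewrite exprn_ge0 ?exprn_ile1//; lra.
Qed.

Lemma step_seq_cvg y : 0 <= y <= 1 ->
  step_seq y n @[n --> \oo] --> ((y < 1 / 2)%R%:R : R).
Proof.
move=> y01; have /andP[y0 y1] := y01.
have yn n : 0 <= y ^+ n <= 1 by rewrite exprn_ge0//= exprn_ile1.
have kE n : (n * 2 ^ n)%N%:R * y ^+ n = n%:R * (2 * y) ^+ n.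
  by rewrite natrM natrX exprMn mulrA.
case: ltP => y12.
  apply: (@squeeze_cvgr _ _ _ _ (fun n => 1 - n%:R * (2 * y) ^+ n) (cst 1)).
  - apply: nearW => n; have /andP[_ ->] := step_seq_itv y n y01; rewrite andbT.
    have := bernoulli_ineq (- y ^+ n) (n * 2 ^ n).
    rewrite mulrN kE; apply; by have := yn n; lra.
  - rewrite -[X in _ --> X]subr0; apply: cvgB; first exact: cvg_cst.
    by apply: cvg_natM_expr; lra.
  - exact: cvg_cst.
(* With u = y^n and k the exponent, (1-u)^k (1+u)^k <= 1, while (1+u)^k >= 1 + n (2y)^n >= n + 1 by
   Bernoulli. *)
apply: (@squeeze_cvgr _ _ _ _ (cst 0) (@harmonic R)).
- apply: nearW => n; have /andP[-> _] := step_seq_itv y n y01 => /=.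
  rewrite /harmonic /= -[leRHS]mul1r ler_pdivlMr//.
  apply: (@le_trans _ _ (step_seq y n * (1 + y ^+ n) ^+ (n * 2 ^ n))).
    rewrite ler_wpM2l//; first by have /andP[] := step_seq_itv y n y01.
    apply: (@le_trans _ _ (1 + n%:R * (2 * y) ^+ n)).
      rewrite -nat1r lerD2l ler_peMr// exprn_ege1//; lra.
    by rewrite -kE bernoulli_ineq//; have := yn n; lra.
  rewrite /step_seq -exprMn -subr_sqr expr1n exprn_ile1//.
    by rewrite subr_ge0 exprn_ile1//; have /andP[] := yn n.
  by rewrite lerBlDr lerDl sqr_ge0.
- exact: cvg_cst.
- exact: cvg_harmonic.
Qed.

(* On [0, 1] these polynomials converge to the indicator of ]-oo, a[; the affine
   change of variable maps [0, 1] into [0, 1] and [a] to 1/2. *)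
Definition step_poly a n : {poly R} :=
  (1 - ((2 * (1 + `|a|))^-1 *: ('X - a%:P) + (1 / 2)%:P) ^+ n) ^+ (n * 2 ^ n).

Lemma step_polyE a n x :
  (step_poly a n).[x] = step_seq ((2 * (1 + `|a|))^-1 * (x - a) + 1 / 2) n.
Proof. by rewrite /step_poly /step_seq !(horner_exp, hornerE). Qed.

Lemma step_poly_arg a x : 0 <= x <= 1 ->
  0 <= (2 * (1 + `|a|))^-1 * (x - a) + 1 / 2 <= 1.
Proof.
move=> /andP[x0 x1].
have h : `|x - a| <= 1 + `|a|.
  by rewrite (le_trans (ler_normB _ _))// lerD2r ger0_norm.
have c0 : 0 < 2 * (1 + `|a|) by have := normr_ge0 a; lra.
have : `|(2 * (1 + `|a|))^-1 * (x - a)| <= 1 / 2.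
  rewrite normrM gtr0_norm ?invr_gt0// mulrC ler_pdivrMr//; lra.
by rewrite ler_norml; lra.
Qed.

Lemma step_poly_itv a n x : 0 <= x <= 1 -> 0 <= (step_poly a n).[x] <= 1.
Proof. by move=> x01; rewrite step_polyE step_seq_itv// step_poly_arg. Qed.

Lemma step_poly_cvg a x : 0 <= x <= 1 ->
  (step_poly a n).[x] @[n --> \oo] --> ((x < a)%R%:R : R).
Proof.
move=> x01; under eq_fun do rewrite step_polyE.
have := step_seq_cvg _ (step_poly_arg a _ x01).
by rewrite -ltrBrDr subrr pmulr_rlt0 ?subr_lt0// invr_gt0.
Qed.

End StepPolynomials.

(** * Closure of a span and convergence of rectangular Fourier sums *)

Section ClosedSpan.
Context d (T : measurableType d) (R : realType) (mu : {measure set T -> \bar R}).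
Implicit Types (f g h : T -> R) (a : R).
Local Notation L2 := (Lfun mu 2%:E).
Local Notation ip := (@inner d T R mu).
Local Notation dist2 f g := (ip (fun x => f x - g x) (fun x => f x - g x)).

Definition linear_closed_pred (W : (T -> R) -> Prop) :=
  W (fun=> 0) /\ forall a f g, W f -> W g -> W (fun x => a * f x + g x).

Definition closed_span (W : (T -> R) -> Prop) f :=
  f \in L2 /\ forall eps : R, 0 < eps ->
    exists g, [/\ g \in L2, W g & dist2 f g < eps].

Lemma ip_zero : ip (fun=> 0) (fun=> 0) = 0.
Proof. exact: ip0l. Qed.

Lemma sub_closed_span W f : f \in L2 -> W f -> closed_span W f.
Proof.
move=> f2 Wf; split=> // eps eps0; exists f; split=> //.
by under eq_fun do rewrite subrr; rewrite ip_zero.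
Qed.

Lemma closed_span_monotone W : linear_closed_pred W ->
  L2_monotone_class _ _ _ mu (closed_span W).
Proof.
move=> [W0 WD]; split; first by apply: sub_closed_span => //; exact: L20.
- move=> a f g [f2 fW] [g2 gW]; split; first by apply: L2D => //; exact: L2Z.
  move=> eps eps0.
  (* [ip_subD] gives 2 a^2 |f-p|^2 + 2 |g-q|^2, and these tolerances keep both summands within
     eps/2; the +1 covers a = 0. *)
  have b0 : 0 < 4 * (a ^+ 2 + 1) by rewrite mulr_gt0// ltr_wpDl// sqr_ge0.
  have [p [p2 Wp fp]] := fW (eps / (4 * (a ^+ 2 + 1))) (divr_gt0 eps0 b0).
  have [q [q2 Wq gq]] := gW (eps / 4) (divr_gt0 eps0 (ltr0n R 4)).
  exists (fun x => a * p x + q x); split; [by apply: L2D => //; exact: L2Z|exact: WD|].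
  rewrite (_ : (fun x => _) = fun x => a * (f x - p x) + (g x - q x)); last first.
    by apply/funext => x; ring.
  have fp2 := L2B _ _ _ _ _ _ f2 p2; have gq2 := L2B _ _ _ _ _ _ g2 q2.
  apply: (le_lt_trans (ip_subD _ _ _ _ _ _ (L2Z _ _ _ _ a _ fp2) gq2)).
  rewrite ipZl//; last exact: L2Z.
  rewrite ipC ipZl// mulrA -expr2.
  move: fp; rewrite ltr_pdivlMr//.
  have := ip_ge0 _ _ _ mu (fun x => f x - p x).
  have := sqr_ge0 a; nra.
- move=> f_ f g Vf_ g2 f_g f_f.
  have mf_ n : measurable_fun setT (f_ n) by have [/L2_measurable] := Vf_ n.
  have [f2 cf] := L2_dominated_cvg _ _ _ _ _ _ _ mf_ g2 f_g f_f.
  split=> // eps eps0.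
  have e4 : 0 < eps / 4 by rewrite divr_gt0.
  have [n _ /(_ _ (leqnn n))] := cvgr_lt _ cf _ e4.
  have [fn2 /(_ _ e4) [q [q2 Wq fq]]] := Vf_ n => fn.
  exists q; split=> //.
  rewrite (_ : (fun x => _) = fun x => (f x - f_ n x) + (f_ n x - q x)); last first.
    by apply/funext => x; ring.
  apply: le_lt_trans (ip_subD _ _ _ _ _ _ (L2B _ _ _ _ _ _ f2 fn2) (L2B _ _ _ _ _ _ fn2 q2)) _.
  lra.
Qed.

Context (e : nat * nat -> T -> R).
Context (e2 : forall k, e k \in L2) (eo : forall k l, ip (e k) (e l) = (k == l)%:R).

Definition rect m n : seq (nat * nat) := [seq (i, j) | i <- iota 0 m, j <- iota 0 n].

Lemma mem_rect m n i j : ((i, j) \in rect m n) = (i < m)%N && (j < n)%N.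
Proof.
apply/allpairsP/andP => [[[k l] /= [+ + [-> ->]]]|[im jn]].
  by rewrite !mem_iota.
by exists (i, j); rewrite /= !mem_iota.
Qed.

Lemma uniq_rect m n : uniq (rect m n).
Proof.
by apply: allpairs_uniq; rewrite ?iota_uniq// => -[i j] [k l] _ _ [-> ->].
Qed.

Local Notation fourier := (@fourier_sum d T R mu _ e).

(** Stands for the linear span of the [e k]. Reproduction by all large rectangles is what
    [fourier_cvg] uses, and it spares carrying coefficients. *)
Definition rect_span q := q \in L2 /\
  exists N, forall m n, (N <= m)%N -> (N <= n)%N -> fourier (rect m n) q = q.

Lemma fourierDZ r a f g : f \in L2 -> g \in L2 ->
  fourier r (fun x => a * f x + g x) = fun x => a * fourier r f x + fourier r g x.
Proof.
move=> f2 g2; apply/funext => x; rewrite /fourier_sum mulr_sumr -big_split/=.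
apply: eq_bigr => k _; rewrite ipDl//; last exact: L2Z.
by rewrite ipZl//; ring.
Qed.

Lemma rect_span_linear : linear_closed_pred rect_span.
Proof.
split.
  split; first exact: L20.
  exists 0%N => m n _ _; apply/funext => x; rewrite /fourier_sum.
  by rewrite big1// => k _; rewrite ip0l mul0r.
move=> a f g [f2 [N fN]] [g2 [M gM]]; split; first by apply: L2D => //; exact: L2Z.
exists (maxn N M) => m n; rewrite !geq_max => /andP[Nm Mm] /andP[Nn Mn].
by rewrite fourierDZ// fN// gM.
Qed.

Lemma rect_span_e k : rect_span (e k).
Proof.
split=> //; case: k => i j; exists (maxn i j).+1 => m n hm hn; apply/funext => x.
rewrite /fourier_sum (bigD1_seq (i, j)) ?uniq_rect//=; last first.
  by rewrite mem_rect; apply/andP; split; lia.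
by rewrite eo eqxx mul1r big1 ?addr0// => k kij; rewrite eo eq_sym (negbTE kij) mul0r.
Qed.

(* Orthogonal projections are best approximations, so density of the span forces
   convergence of all rectangular partial sums. *)
Lemma fourier_cvg f : closed_span rect_span f -> forall eps : R, 0 < eps ->
  exists N, forall m n, (N <= m)%N -> (N <= n)%N -> dist2 f (fourier (rect m n) f) < eps.
Proof.
move=> [f2 fW] eps /fW[q [q2 [_ [N qN]] fq]]; exists N => m n Nm Nn.
apply: le_lt_trans fq.
have fq2 := L2B _ _ _ _ _ _ f2 q2.
(* Applied to f - q: q is reproduced by its Fourier sum, so f - q and f have the same residual. *)
have := ip_fourier_le _ _ _ _ _ _ (rect m n) _ e2 eo (uniq_rect m n) fq2.
rewrite [X in ip X X](_ : _ = fun x => f x - fourier (rect m n) f x)//.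
have -> : (fun x => f x - q x) = fun x => -1 * q x + f x by apply/funext => x; ring.
by apply/funext => x; rewrite fourierDZ// qN//; ring.
Qed.

End ClosedSpan.

(** * The unit square *)

Section UnitSquare.
Context {R : realType}.
Local Notation mu := (@lebesgue_measure R).
Local Notation mu2 := (@lebesgue_measure R \x @lebesgue_measure R)%E.
Local Notation L2 := (Lfun mu2 2%:E).
Local Notation ip := (@inner _ _ R mu2).
Local Notation sq := (@unit_square R).
Implicit Types (u v : R -> R) (f g : R * R -> R).

Lemma unit_squareE (x : R * R) : sq x <-> (0 <= x.1 <= 1) /\ (0 <= x.2 <= 1).
Proof. by rewrite /unit_square /= !in_itv. Qed.

Lemma measurable_unit_square : measurable sq.
Proof. by apply: measurableX; exact: measurable_itv. Qed.

Lemma mu_unit : mu `[0, 1] = 1%E.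
Proof. by rewrite lebesgue_measure_itv /= lte_fin ltr01 oppr0 adde0. Qed.

Lemma mu2_unit_square : mu2 sq = 1%E.
Proof.
rewrite -[RHS]mule1 -{1}mu_unit -mu_unit.
by apply: product_measure1E; exact: measurable_itv.
Qed.

Lemma L2_indic_square : (\1_sq : R * R -> R) \in L2.
Proof.
apply: L2P; first exact: measurable_indic measurable_unit_square.
under eq_integral => x _.
  rewrite (_ : \1_sq x ^+ 2 = \1_sq x); last first.
    by rewrite indicE; case: (x \in sq); rewrite ?expr1n ?expr0n.
  over.
rewrite integral_indic//; last exact: measurable_unit_square.
by rewrite setIT [ltLHS]mu2_unit_square ltry.
Qed.

Lemma L2_bounded f (C : R) : measurable_fun setT f ->
  (forall x, `|f x| <= C * \1_sq x) -> f \in L2.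
Proof.
move=> mf fC.
apply: (L2_dominated _ _ _ mu2 f _ mf (L2Z _ _ _ mu2 C _ L2_indic_square)) => x.
exact: le_trans (fC x) (ler_norm _).
Qed.

(** A class of factors containing both polynomials and indicators; bounding on [0, 1] only is what
    admits polynomials. *)
Definition bounded_meas u :=
  measurable_fun setT u /\ exists C : R, forall x, 0 <= x <= 1 -> `|u x| <= C.

Lemma bounded_meas_horner (p : {poly R}) : bounded_meas (horner p).
Proof.
split; first exact: measurable_poly.
exists (\sum_(i < size p) `|p`_i|) => x /andP[x0 x1]; rewrite horner_coef.
apply: le_trans (ler_norm_sum _ _ _) _; apply: ler_sum => i _.
by rewrite normrM [`|x ^+ i|]ger0_norm ?exprn_ge0// ler_piMr// exprn_ile1.
Qed.

Lemma bounded_meas_indic (A : set R) : measurable A -> bounded_meas \1_A.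
Proof.
move=> mA; split; first exact: measurable_indic.
by exists 1 => x _; rewrite indicE; case: (x \in A); rewrite ?normr1 ?normr0.
Qed.

Lemma bounded_measM u v : bounded_meas u -> bounded_meas v ->
  bounded_meas (fun x => u x * v x).
Proof.
move=> [mu1 [C uC]] [mv [C' vC]]; split; first exact: measurable_funM.
by exists (C * C') => x x01; rewrite normrM ler_pM// ?uC ?vC.
Qed.

Lemma bounded_meas_integrable u : bounded_meas u ->
  mu.-integrable `[0, 1] (EFin \o u).
Proof.
move=> [mu1 [C uC]]; apply: measurable_bounded_integrable => //.
- by rewrite [ltLHS]mu_unit ltry.
- exact: measurable_funS mu1.
- exists C; split; first exact: num_real.
  move=> y Cy x /=; rewrite in_itv/= => x01.
  exact: le_trans (uC x x01) (ltW Cy).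
Qed.

Definition tens u v : R * R -> R := (fun x => u x.1 * v x.2) \_ sq.

Lemma tensE u v x : tens u v x = u x.1 * v x.2 * \1_sq x.
Proof. by rewrite /tens patchE indicE; case: (x \in sq); rewrite ?mulr1 ?mulr0. Qed.

Lemma L2_tens u v : bounded_meas u -> bounded_meas v -> tens u v \in L2.
Proof.
move=> [mu1 [C uC]] [mv [C' vC]]; apply: (@L2_bounded _ (C * C')).
  apply: (measurable_restrictT _ measurable_unit_square).1.
  apply: measurable_funTS; apply: measurable_funM.
    exact: (measurableT_comp mu1 measurable_fst).
  exact: (measurableT_comp mv measurable_snd).
move=> x; rewrite tensE indicE; case: (boolP (x \in sq)) => [|_].
  rewrite in_setE => /unit_squareE[x1 x2].
  by rewrite !mulr1 normrM ler_pM// ?uC ?vC.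
by rewrite !mulr0 normr0.
Qed.

Lemma ip_tens u v u' v' : bounded_meas u -> bounded_meas v ->
  bounded_meas u' -> bounded_meas v' ->
  ip (tens u v) (tens u' v') =
  (\int[mu]_(x in `[0, 1]) (u x * u' x)) * (\int[mu]_(x in `[0, 1]) (v x * v' x)).
Proof.
move=> bu bv bu' bv'.
have i2 := ip_integrable _ _ _ _ _ _ (L2_tens _ _ bu bv) (L2_tens _ _ bu' bv').
rewrite /inner {1}/Rintegral -(integral12_prod_meas1 i2) /fubini_F.
set K := \int[mu]_(x in `[0, 1]) (v x * v' x).
have iv := bounded_meas_integrable _ (bounded_measM _ _ bv bv').
have iu := bounded_meas_integrable _ (bounded_measM _ _ bu bu').
transitivity (fine (\int[mu]_(x in `[0%R, 1%R]) (u x * u' x * K)%:E)%E).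
  congr fine; rewrite [RHS]integral_mkcond; apply: eq_integral => x _.
  rewrite patchE; case: ifPn => [|/negP]; rewrite in_setE/= in_itv/= => x01.
    transitivity (\int[mu]_(y in `[0%R, 1%R]) ((u x * u' x)%:E * (v y * v' y)%:E))%E.
      rewrite [RHS]integral_mkcond; apply: eq_integral => y _.
      rewrite !patchE /= !tensE indicE.
      have -> : ((x, y) \in sq) = (y \in `[0%R, 1%R]%classic).
        apply/idP/idP; rewrite !in_setE /= in_itv/=; first by move=> /unit_squareE[].
        by move=> y01; apply/unit_squareE.
      case: ifPn => _; rewrite ?mulr0 ?mul0r// -EFinM; congr EFin.
      by rewrite !mulr1; ring.
    rewrite integralZl// [RHS]EFinM; congr (_ * _)%E.
    by rewrite /K /Rintegral fineK//; exact: integrable_fin_num.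
  apply: integral0_eq => y _; rewrite /= tensE indicE memNset ?mulr0 ?mul0r//.
  by move=> /unit_squareE[/x01].
exact: RintegralZr.
Qed.

Lemma ip_tens_horner (p q p' q' : {poly R}) :
  ip (tens (horner p) (horner q)) (tens (horner p') (horner q')) =
  Jint (p * p') * Jint (q * q').
Proof.
rewrite ip_tens; [|exact: bounded_meas_horner..].
by congr (_ * _); apply: eq_Rintegral => x _; rewrite hornerM.
Qed.

End UnitSquare.

Section OrthLimit.
Context d (T : measurableType d) (R : realType) (mu : {measure set T -> \bar R}).

(** By Cauchy-Schwarz (f, h)^2 = (f-g, h)^2 <= |f-g|^2 |h|^2, whence the tolerance eps / (|h|^2 +
    1). *)
Lemma ip_orth_limit (f h : T -> R) : f \in Lfun mu 2%:E -> h \in Lfun mu 2%:E ->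
  (forall eps : R, 0 < eps -> exists g, [/\ g \in Lfun mu 2%:E, inner _ _ _ mu g h = 0 &
     inner _ _ _ mu (fun x => f x - g x) (fun x => f x - g x) < eps]) ->
  inner _ _ _ mu f h = 0.
Proof.
move=> f2 h2 H; apply/eqP; rewrite -sqrf_eq0 eq_le sqr_ge0 andbT.
apply/ler_addgt0Pr => eps eps0; rewrite add0r.
have hh0 := ip_ge0 _ _ _ mu h.
have h1 : 0 < inner _ _ _ mu h h + 1 by rewrite ltr_wpDl.
have [g [g2 gh fg]] := H _ (divr_gt0 eps0 h1).
have fg2 := L2B _ _ _ _ _ _ f2 g2.
have := ip_CS _ _ _ _ _ _ fg2 h2; rewrite ipBl// gh subr0 => /le_trans; apply.
move: fg; rewrite ltr_pdivlMr//; have := ip_ge0 _ _ _ mu (fun x => f x - g x).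
nra.
Qed.

End OrthLimit.

(** * Density of the Legendre products in L^2 of the square *)

Section SquareDensity.
Context {R : realType}.
Local Notation mu := (@lebesgue_measure R).
Local Notation mu2 := (@lebesgue_measure R \x @lebesgue_measure R)%E.
Local Notation L2 := (Lfun mu2 2%:E).
Local Notation ip := (@inner _ _ R mu2).
Local Notation sq := (@unit_square R).
Local Notation P := (@legendreP R).
Implicit Types (u v : R -> R) (f g : R * R -> R) (p q : {poly R}).

(** DN integrates over the first variable; facts about integration over the second one are carried
    over by [swap]. *)
Definition swap (x : R * R) : R * R := (x.2, x.1).

Lemma L2_swap f : f \in L2 -> (f \o swap) \in L2.
Proof.
move=> f2; have mf := L2_measurable _ _ _ _ _ f2.
have msw : measurable_fun setT swap.
  by apply: measurable_fun_pair; [exact: measurable_snd|exact: measurable_fst].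
have mfs : measurable_fun setT (f \o swap) by exact: measurableT_comp.
apply: L2P => //.
have mf2 : measurable_fun setT (fun x => (f x ^+ 2)%:E).
  by apply/measurable_EFinP; exact: measurable_funX.
have mfs2 : measurable_fun setT (fun x => ((f \o swap) x ^+ 2)%:E).
  by apply/measurable_EFinP; exact: measurable_funX.
have /integrableP[_] := Lfun2_integrable_sqr f2.
under eq_integral do rewrite /= ger0_norm ?sqr_ge0//.
rewrite fubini_tonelli2//; last by move=> x; rewrite lee_fin sqr_ge0.
by rewrite fubini_tonelli1//; move=> x; rewrite lee_fin sqr_ge0.
Qed.

Lemma ip_swap f g : f \in L2 -> g \in L2 -> ip (f \o swap) (g \o swap) = ip f g.
Proof.
move=> f2 g2; have fs2 := L2_swap _ f2; have gs2 := L2_swap _ g2.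
have i1 := ip_integrable _ _ _ _ _ _ f2 g2.
have i2 := ip_integrable _ _ _ _ _ _ fs2 gs2.
by rewrite /inner /Rintegral -(integral12_prod_meas1 i2) -(integral21_prod_meas1 i1).
Qed.

Lemma tens_swap u v : tens u v \o swap = tens v u.
Proof.
apply/funext => -[x y]; rewrite /= !tensE !indicE /=.
have -> : (swap (x, y) \in sq) = ((x, y) \in sq).
  by apply/idP/idP; rewrite !in_setE => /unit_squareE[? ?]; apply/unit_squareE.
by rewrite (mulrC (v x)).
Qed.

Definition legendre2 (k : nat * nat) : R * R -> R :=
  tens (horner (P k.1)) (horner (P k.2)).

Lemma L2_tens_horner p q : tens (horner p) (horner q) \in L2.
Proof. by apply: L2_tens; exact: bounded_meas_horner. Qed.

Lemma L2_legendre2 k : legendre2 k \in L2. Proof. exact: L2_tens_horner. Qed.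

Lemma legendre2_orthonormal k l : ip (legendre2 k) (legendre2 l) = (k == l)%:R.
Proof.
rewrite ip_tens_horner !legendreP_orthonormal; case: k l => [i j] [k l] /=.
by rewrite xpair_eqE; case: eqP; case: eqP; rewrite /= ?mulr1 ?mulr0 ?mul0r.
Qed.

Local Notation V := (closed_span _ _ _ mu2 (rect_span _ _ _ mu2 legendre2)).

Let VV : L2_monotone_class _ _ _ mu2 V.
Proof. by apply: closed_span_monotone; apply: rect_span_linear L2_legendre2. Qed.

Lemma closed_span_tens_horner p q : V (tens (horner p) (horner q)).
Proof.
have [V0 VD _] := VV.
have tens0 v : tens (horner 0) v = fun=> 0.
  by apply/funext => x; rewrite tensE horner0 !mul0r.
have tens0r u : tens u (horner 0) = fun=> 0.
  by apply/funext => x; rewrite tensE horner0 mulr0 mul0r.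
apply: (legendreP_ind (size p) (fun p => V (tens (horner p) (horner q)))) => //.
- by rewrite tens0.
- move=> p1 p2 V1 V2; have := VD 1 _ _ V1 V2.
  rewrite (_ : (fun x => _) = tens (horner (p1 + p2)) (horner q))//.
  by apply/funext => x; rewrite !tensE hornerD; ring.
- move=> c p1 V1; have := VD c _ _ V1 V0.
  rewrite (_ : (fun x => _) = tens (horner (c *: p1)) (horner q))//.
  by apply/funext => x; rewrite addr0 !tensE hornerZ; ring.
move=> i _; apply: (legendreP_ind (size q) (fun q => V (tens (horner (P i)) (horner q)))) => //.
- by rewrite tens0r.
- move=> p1 p2 V1 V2; have := VD 1 _ _ V1 V2.
  rewrite (_ : (fun x => _) = tens (horner (P i)) (horner (p1 + p2)))//.
  by apply/funext => x; rewrite !tensE hornerD; ring.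
- move=> c p1 V1; have := VD c _ _ V1 V0.
  rewrite (_ : (fun x => _) = tens (horner (P i)) (horner (c *: p1)))//.
  by apply/funext => x; rewrite addr0 !tensE (hornerZ c p1); ring.
move=> j _; apply: sub_closed_span; first exact: L2_tens_horner.
apply: (rect_span_e _ _ _ _ _ L2_legendre2 legendre2_orthonormal (i, j)).
Qed.

Definition poly_limit u := exists2 u_ : nat -> {poly R},
  (forall n x, 0 <= x <= 1 -> `|(u_ n).[x]| <= 1) &
  (forall x, 0 <= x <= 1 -> (u_ n).[x] @[n --> \oo] --> u x).

Lemma poly_limit1 : poly_limit \1_(@setT R).
Proof.
exists (fun=> 1) => [n x _|x _]; first by rewrite hornerC normr1.
by rewrite indicE in_setT hornerC; exact: cvg_cst.
Qed.

Lemma poly_limit_ray a : poly_limit \1_(`]-oo, a[%classic).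
Proof.
exists (step_poly a) => [n x x01|x x01].
  by have /andP[h0 h1] := step_poly_itv a n x x01; rewrite ger0_norm.
rewrite indicE (_ : (x \in _) = (x < a)); first exact: step_poly_cvg.
by apply/idP/idP; rewrite in_setE /= in_itv.
Qed.

Lemma closed_span_poly_limit u v : poly_limit u -> poly_limit v -> V (tens u v).
Proof.
move=> [u_ u1 uc] [v_ v1 vc]; have [_ _ Vc] := VV.
apply: (Vc (fun n => tens (horner (u_ n)) (horner (v_ n))) _ \1_sq).
- by move=> n; exact: closed_span_tens_horner.
- exact: L2_indic_square.
- move=> n x; rewrite tensE indicE; case: (boolP (x \in sq)) => [|_].
    rewrite in_setE => /unit_squareE[x1 x2].
    by rewrite mulr1 normrM mulr_ile1// ?u1 ?v1.
  by rewrite mulr0 normr0.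
- move=> x; under eq_fun do rewrite tensE.
  rewrite tensE indicE; case: (boolP (x \in sq)) => [|_].
    rewrite in_setE => /unit_squareE[x1 x2].
    by apply: cvgM; [apply: cvgM; [exact: uc|exact: vc]|exact: cvg_cst].
  by under eq_fun do rewrite mulr0; rewrite mulr0; exact: cvg_cst.
Qed.

Let tens_indic (A B : set R) :
  tens \1_A \1_B = \1_(fst @^-1` A `&` (snd @^-1` B `&` sq)).
Proof.
by apply/funext => x; rewrite tensE 2!indicI/= mulrA !indicE.
Qed.

Let measurable_rays : @measurable _ R = <<s @RGenInftyO.G R >>.
Proof. exact: RGenInftyO.measurableE. Qed.

Let rays_setI : setI_closed (@RGenInftyO.G R).
Proof.
move=> _ _ [a ->] [b ->]; exists (Num.min a b); apply/seteqP; split => x /=.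
  by rewrite !in_itv/= lt_min => -[-> ->].
by rewrite !in_itv/= lt_min => /andP[].
Qed.

Let sqE : \1_sq = tens \1_(@setT R) \1_(@setT R).
Proof. by rewrite tens_indic !preimage_setT !setTI. Qed.

(** One factor is freed at a time: first A, with B a ray or the whole line, then B with A fixed. *)
Lemma closed_span_indic2 (A B : set R) : measurable A -> measurable B ->
  V (tens \1_A \1_B).
Proof.
move=> mA mB.
have msqI (C : set R) : measurable C -> measurable (snd @^-1` C `&` sq).
  move=> mC; apply: measurableI; last exact: measurable_unit_square.
  by rewrite -[X in measurable X]setTI; apply: measurable_snd.
have E1 (C : set R) : \1_(snd @^-1` C `&` sq) = tens \1_(@setT R) \1_C.
  by rewrite tens_indic preimage_setT setTI.
have E2 (C : set R) : \1_(fst @^-1` C `&` sq) = tens \1_C \1_(@setT R).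
  by rewrite tens_indic preimage_setT setTI.
have L2_ind (C C' : set R) : measurable C -> measurable C' -> tens \1_C \1_C' \in L2.
  by move=> mC mC'; apply: L2_tens; exact: bounded_meas_indic.
have step1 a (C : set R) : measurable C -> V (tens \1_C \1_(`]-oo, a[%classic)).
  rewrite tens_indic; move: C.
  apply: (monotone_class_indic _ _ _ mu2 _ VV _ _ _ _ _ fst _ measurable_rays rays_setI).
  - by rewrite E1; apply: closed_span_poly_limit; [exact: poly_limit1|exact: poly_limit_ray].
  - by rewrite E1; apply: L2_ind.
  - move=> _ [b ->]; rewrite -tens_indic.
    by apply: closed_span_poly_limit; exact: poly_limit_ray.
(* Needed because the final Dynkin argument takes E to be the strip over A, whose indicator must
   already lie in V. *)
have step0 (C : set R) : measurable C -> V (tens \1_C \1_(@setT R)).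
  rewrite -E2; move: C.
  apply: (monotone_class_indic _ _ _ mu2 _ VV _ _ _ _ _ fst _ measurable_rays rays_setI).
  - by rewrite sqE; apply: closed_span_poly_limit; exact: poly_limit1.
  - exact: L2_indic_square.
  - by move=> _ [b ->]; rewrite E2; apply: closed_span_poly_limit;
      [exact: poly_limit_ray|exact: poly_limit1].
rewrite tens_indic setIA (setIC (fst @^-1` _)) -setIA.
move: B mB; apply: (monotone_class_indic _ _ _ mu2 _ VV _ _ _ _ _ snd _ measurable_rays rays_setI).
- by rewrite E2; exact: step0.
- by rewrite E2; apply: L2_ind.
- by move=> _ [b ->]; rewrite setIA (setIC (snd @^-1` _)) -setIA -tens_indic; exact: step1.
Qed.

(** One more Dynkin argument, with [phi] the identity and measurable rectangles as generators,
    reaches all measurable sets; [L2_induction] does the rest. *)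
Lemma closed_span_square f : f \in L2 -> (forall x, ~ sq x -> f x = 0) -> V f.
Proof.
apply: (L2_induction _ _ _ mu2 _ VV).
have := monotone_class_indic _ _ _ mu2 _ VV sq _ _ _ _ id _
  (measurable_prod_measurableType _ _).
move=> H A mA; rewrite -[A]/(id @^-1` A); apply: H => //.
- by rewrite sqE; apply: closed_span_poly_limit; exact: poly_limit1.
- exact: L2_indic_square.
- move=> _ _ [B mB [C mC <-]] [B' mB' [C' mC' <-]].
  exists (B `&` B'); first exact: measurableI.
  by exists (C `&` C'); [exact: measurableI|rewrite setXI].
- move=> _ [B mB [C mC <-]]; have := closed_span_indic2 B C mB mC.
  by rewrite tens_indic setIA.
Qed.

End SquareDensity.

Section AlmostEverywhere.
Context d (T : measurableType d) (R : realType) (m : {measure set T -> \bar R}).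

Lemma ae_imply (Q Q' : T -> Prop) : (forall x, Q x -> Q' x) ->
  {ae m, forall x, Q x} -> {ae m, forall x, Q' x}.
Proof. by move=> QQ'; apply: filterS. Qed.

Lemma ae_imply2 (Q Q' Q2 : T -> Prop) : (forall x, Q x -> Q' x -> Q2 x) ->
  {ae m, forall x, Q x} -> {ae m, forall x, Q' x} -> {ae m, forall x, Q2 x}.
Proof. by move=> QQ'; apply: filterS2. Qed.

End AlmostEverywhere.

(** * Fubini: inner products on the square against integrals of sections *)

Section Sections.
Context {R : realType}.
Local Notation mu := (@lebesgue_measure R).
Local Notation mu2 := (@lebesgue_measure R \x @lebesgue_measure R)%E.
Local Notation L2 := (Lfun mu2 2%:E).
Local Notation ip := (@inner _ _ R mu2).
Local Notation sq := (@unit_square R).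
Local Notation P := (@legendreP R).
Implicit Types (u v : R -> R) (f g : R * R -> R) (p q : {poly R}).

Lemma section_tens f u v x : 0 <= x <= 1 ->
  (fun y => ((f \_ sq) (x, y) * tens u v (x, y))%:E) =
  (fun y => (f (x, y) * (u x * v y))%:E) \_ `[0%R, 1%R]%classic.
Proof.
move=> x01; apply/funext => y; rewrite !patchE tensE indicE /=.
have -> : ((x, y) \in sq) = (y \in `[0%R, 1%R]%classic).
  apply/idP/idP; rewrite !in_setE /= in_itv/=; first by move=> /unit_squareE[].
  by move=> y01; apply/unit_squareE.
by case: ifPn => _; rewrite ?mulr1 ?mul0r.
Qed.

Lemma integral_section f u v x : 0 <= x <= 1 ->
  (\int[mu]_y ((f \_ sq) (x, y) * tens u v (x, y))%:E =
   \int[mu]_(y in `[0%R, 1%R]) (f (x, y) * (u x * v y))%:E)%E.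
Proof. by move=> x01; rewrite section_tens// [RHS]integral_mkcond. Qed.

Lemma integral_section_out f u v x : ~ 0 <= x <= 1 ->
  (\int[mu]_y ((f \_ sq) (x, y) * tens u v (x, y))%:E = 0)%E.
Proof.
move=> x01; apply: integral0_eq => y _; rewrite tensE indicE memNset ?mulr0//.
by move=> /unit_squareE[/x01].
Qed.

Let bm1 : bounded_meas (fun=> 1 : R).
Proof. by split; [exact: measurable_cst|exists 1 => x _; rewrite normr1]. Qed.

Lemma ae_integrable_section f v : f \_ sq \in L2 -> bounded_meas v ->
  {ae mu, forall x : R, 0 <= x <= 1 ->
    mu.-integrable `[0%R, 1%R] (fun y => (f (x, y) * v y)%:E)}.
Proof.
move=> f2 bv.
have : {ae mu, forall x : R, mu.-integrable setT
    (fun y => ((f \_ sq) (x, y) * tens (fun=> 1) v (x, y))%:E)}.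
  exact: (ae_integrable1 (ip_integrable _ _ _ _ _ _ f2 (L2_tens _ _ bm1 bv))).
refine (ae_imply _ _ _ mu _ _ _) => x /= + x01.
rewrite section_tens//.
move=> h; have := (@integrable_mkcond _ _ _ mu _ _ (measurable_itv `[0%R, 1%R])).2 h.
suff -> : (fun y : R => (f (x, y) * (1 * v y))%:E) = (fun y => (f (x, y) * v y)%:E) by [].
by apply/funext => y; rewrite mul1r.
Qed.

Lemma ip_section0 f u v : f \_ sq \in L2 -> bounded_meas u -> bounded_meas v ->
  {ae mu, forall x : R, 0 <= x <= 1 ->
    (\int[mu]_(y in `[0%R, 1%R]) (f (x, y) * v y)%:E = 0)%E} ->
  ip (f \_ sq) (tens u v) = 0.
Proof.
move=> f2 bu bv fv0.
have i2 := ip_integrable _ _ _ _ _ _ f2 (L2_tens _ _ bu bv).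
rewrite /inner /Rintegral -(integral12_prod_meas1 i2) /fubini_F.
rewrite (_ : (\int[_]_x _ = 0)%E)//.
rewrite -[RHS](integral0 mu setT); apply: ae_eq_integral => //.
  exact: measurable_fubini_F i2.
have := ae_integrable_section _ _ f2 bv; move: fv0; refine (ae_imply2 _ _ _ mu _ _ _ _) => x /= fv0 iv _.
have [x01|x01] := pselect (0 <= x <= 1); last exact: integral_section_out.
rewrite integral_section//.
under eq_integral do rewrite mulrCA EFinM.
by rewrite integralZl//; [rewrite fv0 ?mule0|exact: iv].
Qed.

(** By Fubini the hypothesis says that the inner integral, as a function of x, has integral zero
    over every measurable A; hence it vanishes almost everywhere. *)
Lemma section0_ip f v : f \_ sq \in L2 -> bounded_meas v ->
  (forall A, measurable A -> ip (f \_ sq) (tens \1_A v) = 0) ->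
  {ae mu, forall x : R, 0 <= x <= 1 ->
    (\int[mu]_(y in `[0%R, 1%R]) (f (x, y) * v y)%:E = 0)%E}.
Proof.
move=> f2 bv fA.
have i2 := ip_integrable _ _ _ _ _ _ f2 (L2_tens _ _ bm1 bv).
have : ae_eq mu setT (fubini_F mu (EFin \o (fun x => (f \_ sq) x * tens (fun=> 1) v x)))
    (cst 0%E).
  apply: integral_ae_eq => //; first exact: integrable_fubini_F i2.
  move=> A _ mA; rewrite integral0 integral_mkcond.
  have bA := bounded_meas_indic A mA.
  have iA := ip_integrable _ _ _ _ _ _ f2 (L2_tens _ _ bA bv).
  transitivity (ip (f \_ sq) (tens \1_A v))%:E; last by rewrite fA.
  rewrite -integral_ip//; last exact: L2_tens.
  rewrite -(integral12_prod_meas1 iA); apply: eq_integral => x _.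
  rewrite patchE /fubini_F; case: ifPn => xA.
    by apply: eq_integral => y _; rewrite /= !tensE [\1_A _]indicE /= xA.
  by rewrite integral0_eq// => y _; rewrite /= tensE [\1_A _]indicE /= (negbTE xA) !mul0r mulr0.
refine (ae_imply _ _ _ mu _ _ _) => x /= + x01 => /(_ Logic.I) <-.
rewrite /fubini_F [RHS]integral_section//.
by apply: eq_integral => y _; rewrite mul1r.
Qed.

End Sections.

Lemma sum_nat_zero_prefix (V : nmodType) (a m : nat) (F : nat -> V) :
  (forall i, (i < a)%N -> F i = 0) ->
  \sum_(a <= i < m) F i = \sum_(0 <= i < m) F i.
Proof.
move=> F0.
have S0 n : (n <= a)%N -> \sum_(0 <= i < n) F i = 0.
  move=> na; rewrite big_nat big1// => i /andP[_ i_n].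
  by apply: F0; exact: leq_trans na.
have [am|/ltnW ma] := leqP a m; last by rewrite (big_geq ma) S0.
by rewrite [RHS](@big_cat_nat _ _ _ a)//= S0// add0r.
Qed.

(** * Vanishing moments and double series *)

Section Core.
Context {R : realType}.
Local Notation mu := (@lebesgue_measure R).
Local Notation mu2 := (@lebesgue_measure R \x @lebesgue_measure R)%E.
Local Notation L2 := (Lfun mu2 2%:E).
Local Notation ip := (@inner _ _ R mu2).
Local Notation sq := (@unit_square R).
Local Notation P := (@legendreP R).
Implicit Types (u v : R -> R) (f g h D S : R * R -> R) (p q : {poly R}).

(** Shaped after CN with k standing for kappa - 1, so that b = eta - 1. *)
Definition moments0 (b : nat) f := forall k, (k < b)%N ->
  {ae mu, forall x : R, 0 <= x <= 1 ->
    (\int[mu]_(y in `[0%R, 1%R]) (f (x, y) * y ^+ k)%:E = 0)%E}.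

Lemma patch_swap f : (f \o swap) \_ sq = (f \_ sq) \o swap.
Proof.
apply/funext => -[x y]; rewrite /= !patchE /=.
suff -> : (swap (x, y) \in sq) = ((x, y) \in sq) by [].
by apply/idP/idP; rewrite !in_setE => /unit_squareE[? ?]; apply/unit_squareE.
Qed.

Lemma L2_patch_swap f : f \_ sq \in L2 -> (f \o swap) \_ sq \in L2.
Proof. by move=> /L2_swap; rewrite patch_swap. Qed.

Lemma hornerXn_fun k : horner ('X^k : {poly R}) = fun y => y ^+ k.
Proof. by apply/funext => y; rewrite hornerXn. Qed.

Lemma moments0_ip b f u q : f \_ sq \in L2 -> moments0 b f -> bounded_meas u ->
  (size q <= b)%N -> ip (f \_ sq) (tens u (horner q)) = 0.
Proof.
move=> f2 fb bu qb.
rewrite (_ : tens u (horner q) =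
    fun x => \sum_(k < size q) q`_k * tens u (horner 'X^k) x); last first.
  apply/funext => x; rewrite tensE horner_coef mulr_sumr mulr_suml.
  by apply: eq_bigr => k _; rewrite tensE hornerXn; ring.
rewrite ipC ip_suml//; last first.
  by move=> k; apply: L2Z; apply: L2_tens => //; exact: bounded_meas_horner.
rewrite big1// => k _; rewrite ipZl//; last first.
  by apply: L2_tens => //; exact: bounded_meas_horner.
rewrite ipC ip_section0 ?mulr0//; first exact: bounded_meas_horner.
by rewrite hornerXn_fun; apply: fb; exact: leq_trans qb.
Qed.

Lemma ip_moments0 b f : f \_ sq \in L2 ->
  (forall A k, measurable A -> (k < b)%N -> ip (f \_ sq) (tens \1_A (horner 'X^k)) = 0) ->
  moments0 b f.
Proof.
move=> f2 fA k kb; have := section0_ip _ _ f2 (bounded_meas_horner 'X^k) (fun A mA => fA A k mA kb).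
by rewrite hornerXn_fun.
Qed.

Lemma ip_patch_swap f u v : f \_ sq \in L2 -> bounded_meas u -> bounded_meas v ->
  ip ((f \o swap) \_ sq) (tens u v) = ip (f \_ sq) (tens v u).
Proof.
by move=> f2 bu bv; rewrite patch_swap -tens_swap ip_swap//; exact: L2_tens.
Qed.

Definition psum (a b : nat) (omega : nat -> nat -> R) (m n : nat) : R * R -> R :=
  fun x => \sum_(a <= i < m) \sum_(b <= j < n) omega i j * legendre2 (i, j) x.

Lemma L2_psum a b omega m n : psum a b omega m n \in L2.
Proof.
apply: L2_sum => i; apply: L2_sum => j; apply: L2Z; exact: L2_legendre2.
Qed.

Lemma patch_psum a b omega m n :
  (fun x : R * R => \sum_(a <= i < m) \sum_(b <= j < n)
     omega i j * (P i).[x.1] * (P j).[x.2]) \_ sq = psum a b omega m n.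
Proof.
apply/funext => x; rewrite /psum patchE; case: ifPn => xs.
  apply: eq_bigr => i _; apply: eq_bigr => j _.
  by rewrite /legendre2 /tens patchE xs mulrA.
by rewrite big1// => i _; rewrite big1// => j _; rewrite /legendre2 /tens patchE (negbTE xs) mulr0.
Qed.

Lemma norm2_square_psum S a b omega m n : S \_ sq \in L2 ->
  norm2_square (fun x => S x - \sum_(a <= i < m) \sum_(b <= j < n)
     omega i j * (P i).[x.1] * (P j).[x.2]) =
  (Num.sqrt (ip (fun x => (S \_ sq) x - psum a b omega m n x)
               (fun x => (S \_ sq) x - psum a b omega m n x)))%:E.
Proof.
move=> S2; rewrite -Lnorm2E; last by apply: L2B => //; exact: L2_psum.
rewrite /norm2_square; congr (Lnorm _ _ (_ \o _)).
rewrite -patch_psum; apply/funext => x; rewrite !patchE.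
by case: ifPn; rewrite ?subr0.
Qed.

Lemma norm2_square_psum_fun S a b omega : S \_ sq \in L2 ->
  (fun mn : nat * nat => norm2_square (fun x => S x -
    \sum_(a <= i < mn.1) \sum_(b <= j < mn.2)
     omega i j * (P i).[x.1] * (P j).[x.2])) =
  EFin \o (fun mn => Num.sqrt (ip (fun x => (S \_ sq) x - psum a b omega mn.1 mn.2 x)
               (fun x => (S \_ sq) x - psum a b omega mn.1 mn.2 x))).
Proof. by move=> S2; apply/funext => mn; rewrite norm2_square_psum. Qed.

(** Every partial sum is orthogonal to h, and orthogonality survives L^2 limits; a single rectangle
    per tolerance suffices. *)
Lemma double_sum_orth S a b omega h : h \in L2 ->
  L2_double_sum a b (fun i j x => omega i j * (P i).[x.1] * (P j).[x.2]) S ->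
  (forall i j, (a <= i)%N -> (b <= j)%N -> ip (legendre2 (i, j)) h = 0) ->
  ip (S \_ sq) h = 0.
Proof.
move=> h2 [S2 cS] hij; apply: ip_orth_limit => // eps eps0.
move: cS; rewrite (norm2_square_psum_fun _ _ _ _ S2) => /fine_cvgP[_ /= cS].
have e0 : 0 < Num.sqrt eps by rewrite sqrtr_gt0.
have [[m n] /= Smn] := filter_ex (cvgr_lt _ cS _ e0).
move: Smn; rewrite ltr_sqrt// => Smn.
exists (psum a b omega m n); split => //; first exact: L2_psum.
rewrite /psum ip_suml//; last by move=> i; apply: L2_sum => j; apply: L2Z; exact: L2_legendre2.
rewrite big_nat big1// => i /andP[ai _].
rewrite ip_suml//; last by move=> j; apply: L2Z; exact: L2_legendre2.
rewrite big_nat big1// => j /andP[bj _].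
by rewrite ipZl//; [rewrite hij// mulr0|exact: L2_legendre2].
Qed.

Lemma legendre2_orth_indic A k i j : measurable A -> (k < j)%N ->
  ip (legendre2 (i, j)) (tens \1_A (horner 'X^k)) = 0.
Proof.
move=> mA kj; rewrite ip_tens;
  [|exact: bounded_meas_horner..|exact: bounded_meas_indic|exact: bounded_meas_horner].
rewrite [X in _ * X](_ : _ = Jint (P j * 'X^k)).
  by rewrite legendreP_ortho_lt ?mulr0// size_polyXn.
by apply: eq_Rintegral => x _; rewrite hornerM.
Qed.

Lemma moments0_of_double_sum D S a b omega : D \_ sq \in L2 ->
  L2_double_sum a b (fun i j x => omega i j * (P i).[x.1] * (P j).[x.2]) S ->
  ae_square (fun x => D x = S x) -> moments0 b D /\ moments0 a (D \o swap).
Proof.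
move=> D2 SS DS; have S2 : S \_ sq \in L2 by case: SS.
have DSip h : h \in L2 -> ip (D \_ sq) h = ip (S \_ sq) h.
  move=> h2; congr fine; apply: ae_eq_integral => //.
  - by have /measurable_int := ip_integrable _ _ _ _ _ _ D2 h2.
  - by have /measurable_int := ip_integrable _ _ _ _ _ _ S2 h2.
  move: DS; refine (ae_imply _ _ _ mu2 _ _ _) => x DSx _ /=.
  rewrite !patchE; case: ifPn => [|_]; last by rewrite mul0r.
  by rewrite in_setE => /DSx ->.
split.
- apply: ip_moments0 => // A k mA kb.
  have h2 : tens \1_A (horner 'X^k) \in L2.
    by apply: L2_tens; [exact: bounded_meas_indic|exact: bounded_meas_horner].
  rewrite DSip// (double_sum_orth _ _ _ _ _ h2 SS)// => i j _ bj.
  by apply: legendre2_orth_indic => //; exact: leq_trans bj.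
- apply: ip_moments0 => [|A k mA ka]; first exact: L2_patch_swap.
  have bA := bounded_meas_indic A mA; have bX := bounded_meas_horner ('X^k : {poly R}).
  have h2 : tens (horner 'X^k) \1_A \in L2 by exact: L2_tens.
  rewrite ip_patch_swap// DSip// (double_sum_orth _ _ _ _ _ h2 SS)// => i j ai _.
  rewrite -ip_swap//; [|exact: L2_legendre2]; rewrite tens_swap /legendre2 tens_swap.
  by apply: (legendre2_orth_indic A k j i) => //; exact: leq_trans ai.
Qed.

(** The omega are the Legendre coefficients of D. The moments annihilate those with i < a or j < b,
    so the sums starting at (a, b) are full rectangular Fourier sums, which converge by density. *)
Lemma double_sum_of_moments0 D a b : D \_ sq \in L2 ->
  moments0 b D -> moments0 a (D \o swap) -> exists omega,
  L2_double_sum a b (fun i j x => omega i j * (P i).[x.1] * (P j).[x.2]) D.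
Proof.
move=> D2 Db Da; pose omega i j := ip (D \_ sq) (legendre2 (i, j)).
have bP i := bounded_meas_horner (P i).
have omb i j : (j < b)%N -> omega i j = 0.
  by move=> jb; apply: (moments0_ip b) => //; rewrite size_legendreP.
have oma i j : (i < a)%N -> omega i j = 0.
  move=> ia; rewrite /omega /legendre2 -ip_patch_swap//=.
  by apply: (moments0_ip a) => //; [exact: L2_patch_swap|rewrite size_legendreP].
have psumE m n : psum a b omega m n =
    fourier_sum _ _ _ mu2 _ legendre2 (rect m n) (D \_ sq).
  apply/funext => x; rewrite /psum /fourier_sum /rect big_allpairs_dep/=.
  rewrite sum_nat_zero_prefix => [|i /oma h]; last first.
    by rewrite big1// => j _; rewrite h mul0r.
  rewrite /index_iota subn0; apply: eq_bigr => i _.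
  rewrite -/(index_iota b n) sum_nat_zero_prefix => [|j /omb ->]; last by rewrite mul0r.
  by rewrite /index_iota subn0.
exists omega; split => //.
rewrite (norm2_square_psum_fun _ _ _ _ D2).
apply/fine_cvgP; split; first exact: nearW.
apply/cvgrPdist_lt => eps eps0.
have DV : closed_span _ _ _ mu2 (rect_span _ _ _ mu2 legendre2) (D \_ sq).
  by apply: closed_span_square => // x; rewrite patchE; case: ifPn => //; rewrite in_setE.
(* [fourier_cvg] measures squared distances, hence eps^2. *)
have [N HN] := fourier_cvg _ _ _ _ _ L2_legendre2 legendre2_orthonormal _ DV _ (exprn_gt0 2 eps0).
exists ([set m | (N <= m)%N], [set n | (N <= n)%N]).
  by split; exact: nbhs_infty_ge.
move=> [m n] /= [Nm Nn]; rewrite sub0r normrN ger0_norm ?sqrtr_ge0//.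
rewrite -(gtr0_norm eps0) -sqrtr_sqr ltr_sqrt ?exprn_gt0//.
by rewrite psumE; exact: HN.
Qed.

End Core.

(** * The explicit kernel *)

Section Kernel.
Context {R : realType}.
Local Notation mu := (@lebesgue_measure R).
Local Notation mu2 := (@lebesgue_measure R \x @lebesgue_measure R)%E.
Local Notation L2 := (Lfun mu2 2%:E).
Local Notation sq := (@unit_square R).
Local Notation P := (@legendreP R).
Local Notation xi := (@xi R).
Implicit Types (f : R * R -> R) (p q : {poly R}) (t s : R).

Lemma horner_kerP e N1 N2 N3 t s : (kerP e N1 N2 N3 t).[s] =
  1 / 6 - e / 2 * xi 1 * (P 1%N).[s] + e / 2 * xi 1 * (P 1%N).[t]
  + \sum_(1 <= i < N1.+1) xi i * xi i.+1 * (P i.-1).[t] * (P i.+1).[s]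
  - \sum_(1 <= i < N2.+1) (xi i ^+ 2 + xi i.+1 ^+ 2) * (P i).[t] * (P i).[s]
  + \sum_(1 <= i < N3.+1) xi i * xi i.+1 * (P i.+1).[t] * (P i.-1).[s].
Proof.
rewrite /kerP; move: (@Defs.xi R) (@legendreP R) => x f.
rewrite !(hornerD, hornerN, hornerZ, hornerC) !horner_sum.
by congr (_ + _ - _ + _); apply: eq_bigr => i _; rewrite hornerZ.
Qed.

Lemma kerP_sym e N1 N2 N3 t s :
  (kerP (- e) N3 N2 N1 s).[t] = (kerP e N1 N2 N3 t).[s].
Proof.
rewrite !horner_kerP.
rewrite (eq_bigr (fun i => xi i * xi i.+1 * (P i.+1).[t] * (P i.-1).[s])); last first.
  by move=> i _; rewrite mulrAC.
rewrite [X in _ + X](eq_bigr (fun i => xi i * xi i.+1 * (P i.-1).[t] * (P i.+1).[s])); last first.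
  by move=> i _; rewrite mulrAC.
rewrite [X in _ - X + _](eq_bigr (fun i =>
  (xi i ^+ 2 + xi i.+1 ^+ 2) * (P i).[t] * (P i).[s])); last first.
  by move=> i _; rewrite mulrAC.
by ring.
Qed.

Lemma L2_kerP e N1 N2 N3 :
  (fun x : R * R => (kerP e N1 N2 N3 x.1).[x.2]) \_ sq \in L2.
Proof.
pose w i j := legendre2 (R := R) (i, j).
have L2w c i j : (fun x => c * w i j x) \in L2 by apply: L2Z; exact: L2_legendre2.
have L2s (N : nat) (c : nat -> R) (k l : nat -> nat) :
      (fun x => \sum_(1 <= i < N) c i * w (k i) (l i) x) \in L2.
  by apply: L2_sum => i; exact: L2w.
have L2e := L2D _ _ _ mu2 _ _ (L2B _ _ _ mu2 _ _ (L2D _ _ _ mu2 _ _ (L2D _ _ _ mu2 _ _ (L2B _ _ _ mu2 _ _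
  (L2w (1 / 6) 0 0) (L2w (e / 2 * xi 1) 0 1)) (L2w (e / 2 * xi 1) 1 0))
  (L2s N1.+1 (fun i => xi i * xi i.+1) predn S))
  (L2s N2.+1 (fun i => xi i ^+ 2 + xi i.+1 ^+ 2) id id))
  (L2s N3.+1 (fun i => xi i * xi i.+1) S predn).
apply: eq_L2 L2e => x; rewrite /w /legendre2 /tens !patchE horner_kerP /=.
case: ifPn => xs; last first.
  rewrite !mulr0; rewrite !big1 ?subr0 ?addr0// => i _; by rewrite patchE (negbTE xs) mulr0.
rewrite !legendreP0 !hornerC !mul1r !mulr1.
by congr (_ + _ - _ + _); apply: eq_bigr => i _; rewrite patchE xs mulrA.
Qed.

(** The integral may be split at each x whose section is integrable, which is almost every x by
    Fubini; there the two equations are equivalent. *)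
Lemma moments0_sub f (kappa : R -> {poly R}) (r : nat -> {poly R}) b :
  f \_ sq \in L2 ->
  (forall x k, (k < b)%N -> Jint (kappa x * 'X^k) = (r k).[x]) ->
  moments0 b (fun x => f x - (kappa x.1).[x.2]) <->
  forall k, (k < b)%N -> {ae mu, forall x : R, 0 <= x <= 1 ->
    (\int[mu]_(y in `[0%R, 1%R]) (f (x, y) * y ^+ k)%:E = ((r k).[x])%:E)%E}.
Proof.
move=> f2 kr.
have E x k : (k < b)%N -> mu.-integrable `[0%R, 1%R] (fun y => (f (x, y) * y ^+ k)%:E) ->
    (\int[mu]_(y in `[0%R, 1%R]) ((f (x, y) - (kappa x).[y]) * y ^+ k)%:E = 0)%E <->
    (\int[mu]_(y in `[0%R, 1%R]) (f (x, y) * y ^+ k)%:E = ((r k).[x])%:E)%E.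
  move=> kb ifx.
  have -> : (\int[mu]_(y in `[0%R, 1%R]) ((f (x, y) - (kappa x).[y]) * y ^+ k)%:E =
     \int[mu]_(y in `[0%R, 1%R]) (f (x, y) * y ^+ k)%:E - ((r k).[x])%:E)%E.
    rewrite -kr// -integral_unit_horner -integralB_EFin//; last exact: integrable_horner.
    by apply: eq_integral => y _; rewrite -EFinD hornerM hornerXn mulrBl.
  have fn : (\int[mu]_(y in `[0%R, 1%R]) (f (x, y) * y ^+ k)%:E \is a fin_num)%E.
    exact: integrable_fin_num.
  rewrite -(fineK fn).
  split=> [|->]; last by rewrite -EFinB subrr.
  by move=> [] /subr0_eq ->.
have ifx k := ae_integrable_section _ _ f2 (bounded_meas_horner 'X^k).
split=> H k kb; have := H k kb; have := ifx k; rewrite hornerXn_fun;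
  refine (ae_imply2 _ _ _ mu _ _ _ _) => x /= + + x01 => /(_ x01) ifx' /(_ x01);
  exact: (E x k kb ifx').1 || exact: (E x k kb ifx').2.
Qed.

Lemma second_antideriv0_Xn k :
  second_antideriv 0 'X^k ((k.+1%:R * k.+2%:R)^-1 *: 'X^(k.+2) : {poly R}).
Proof.
split.
- rewrite derivnS derivn1 !derivZ derivXn derivMn derivXn /= -mulrnA -scalerMnr scalerMnl.
  by rewrite -[RHS]scale1r; congr (_ *: _); rewrite -mulr_natl natrM mulrC mulVf// mulf_neq0 ?pnatr_eq0.
- by rewrite hornerZ hornerXn expr0n mulr0.
- by rewrite derivZ derivXn hornerZ hornerMn hornerXn /= expr0n mul0rn mulr0.
Qed.

(** The linear and constant terms cancel the slope and the value at 1; with kappa = k+1 this is the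
    right-hand side of DN. *)
Lemma second_antideriv1_Xn k :
  second_antideriv 1 'X^k ((k.+1%:R * k.+2%:R)^-1 *: 'X^(k.+2)
     - k.+1%:R^-1 *: 'X + (k.+2%:R^-1)%:P : {poly R}).
Proof.
have [e _ _] := second_antideriv0_Xn k.
split.
- move: e; rewrite derivnS derivn1 => e.
  rewrite derivnS derivn1 derivD derivC addr0 derivB derivB e (derivZ _ 'X) derivX.
  by rewrite derivZ -polyC1 derivC scaler0 subr0.
- rewrite !(hornerD, hornerN, hornerZ, hornerC) hornerXn hornerX expr1n.
  by field; rewrite (natD_neq0 0) (natD_neq0 1).
- rewrite derivD derivB derivC addr0 !derivZ derivXn derivX hornerD hornerN !hornerZ.
  rewrite hornerMn hornerXn hornerC expr1n mulr1.
  by field; rewrite (natD_neq0 0) (natD_neq0 1).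
Qed.

End Kernel.

Theorem theorem3p5 (R : realType) (eta zeta : nat) (M : csRKN R)
    (eta_ge1 : (1 <= eta)%N) (zeta_ge1 : (1 <= zeta)%N)
    (hB : forall t : R, 0 <= t <= 1 -> Bcoef M t = 1)
    (hC : forall t : R, 0 <= t <= 1 -> Ccoef M t = t)
    (hA : L2_square (fun x : R * R => Abar M x.1 x.2)) :
  let P (i : nat) (t : R) : R := (legendreP R i).[t] in
  (* truncated subtraction is harmless in these upper limits: a negative limit
     becomes 0, and the sums below, which start at 1, are empty either way *)
  let N1 := maxn (eta - 3) (zeta - 1) in
  let N2 := maxn (eta - 2) (zeta - 2) in
  let N3 := maxn (eta - 1) (zeta - 3) in
  (CN M eta /\ DN M zeta)
  <->
  (exists (omega : nat -> nat -> R) (S : R * R -> R),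
    L2_double_sum (zeta - 1) (eta - 1)
      (fun i j x => omega i j * P i x.1 * P j x.2) S /\
    ae_square (fun x => let t := x.1 in let s := x.2 in
      Abar M t s =
        1 / 6 - 1 / 2 * xi R 1 * P 1%N s + 1 / 2 * xi R 1 * P 1%N t
        + \sum_(1 <= i < N1.+1) xi R i * xi R i.+1 * P i.-1 t * P i.+1 s
        - \sum_(1 <= i < N2.+1) (xi R i ^+ 2 + xi R i.+1 ^+ 2) * P i t * P i s
        + \sum_(1 <= i < N3.+1) xi R i * xi R i.+1 * P i.+1 t * P i.-1 s
        + S x)).
Proof.
move=> P N1 N2 N3.
pose A (x : R * R) := Abar M x.1 x.2.
pose K t := kerP 1 N1 N2 N3 t : {poly R}.
pose K' s := kerP (-1) N3 N2 N1 s : {poly R}.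
have A2 : A \_ unit_square \in Lfun (@lebesgue_measure R \x @lebesgue_measure R)%E 2%:E := hA.
have D2 : (fun x => A x - (K x.1).[x.2]) \_ unit_square
    \in Lfun (@lebesgue_measure R \x @lebesgue_measure R)%E 2%:E.
  apply: eq_L2 (L2B _ _ _ _ _ _ A2 (L2_kerP 1 N1 N2 N3)) => x.
  by rewrite !patchE; case: ifPn; rewrite ?subr0.
have CNE : CN M eta <-> moments0 (eta - 1) (fun x => A x - (K x.1).[x.2]).
  have kr t k : (k < eta - 1)%N -> Jint (K t * 'X^k) =
      ((k.+1%:R * k.+2%:R)^-1 *: 'X^(k.+2) : {poly R}).[t].
    move=> keta; apply: (@Jint_kerP _ 1 0 _ _ _ (eta - 1)).
    - by rewrite expr1n.
    - by rewrite subrr mul0r.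
    - by rewrite /N1; lia.
    - by rewrite /N2; lia.
    - by rewrite /N3; lia.
    - by rewrite size_polyXn.
    - exact: second_antideriv0_Xn.
  rewrite (moments0_sub _ _ _ _ A2 kr).
  have E k t : 0 <= t <= 1 -> (\int[@lebesgue_measure R]_(s in `[0%R, 1%R])
       (Abar M t s * Ccoef M s ^+ k)%:E =
     \int[@lebesgue_measure R]_(s in `[0%R, 1%R]) (A (t, s) * s ^+ k)%:E)%E.
    move=> t01; apply: eq_integral => s; rewrite inE/= in_itv/= => s01.
    by rewrite hC.
  split=> H k hk.
  - have := H k.+1; rewrite subSS subn0 => /(_ _)/wrap[]; first by lia.
    refine (ae_imply _ _ _ _ _ _ _) => t + t01 => /(_ t01).
    rewrite E// hC// => ->; congr EFin; rewrite hornerZ hornerXn addn1.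
    by rewrite mulrC.
  - case: k hk => // k hk; have := H k; rewrite subSS subn0 => /(_ _)/wrap[]; first by lia.
    refine (ae_imply _ _ _ _ _ _ _) => t + t01 => /(_ t01).
    rewrite E// hC// => ->; congr EFin; rewrite hornerZ hornerXn addn1.
    by rewrite mulrC.
(* Transposition turns K into K', and DN becomes a condition of the shape of CN with base point
   1. *)
have DE : (fun x => A x - (K x.1).[x.2]) \o swap =
    (fun x => (A \o swap) x - (K' x.1).[x.2]).
  by apply/funext => x; rewrite /= /K /K' kerP_sym.
have DNE : DN M zeta <-> moments0 (zeta - 1) ((fun x => A x - (K x.1).[x.2]) \o swap).
  have kr s k : (k < zeta - 1)%N -> Jint (K' s * 'X^k) =
      ((k.+1%:R * k.+2%:R)^-1 *: 'X^(k.+2) - k.+1%:R^-1 *: 'X + (k.+2%:R^-1)%:P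
        : {poly R}).[s].
    move=> kzeta; apply: (@Jint_kerP _ (-1) 1 _ _ _ (zeta - 1)).
    - by rewrite sqrrN expr1n.
    - by field.
    (* In K' the roles of N1 and N3 are exchanged, so the bounds to meet are zeta-3 for N3, zeta-2
       for N2 and zeta-1 for N1. *)
    - by rewrite /N3; lia.
    - by rewrite /N2; lia.
    - by rewrite /N1; lia.
    - by rewrite size_polyXn.
    - exact: second_antideriv1_Xn.
  rewrite DE (moments0_sub _ _ _ _ (L2_patch_swap _ A2) kr).
  have E k s : 0 <= s <= 1 -> (\int[@lebesgue_measure R]_(t in `[0%R, 1%R])
       (Bcoef M t * Ccoef M t ^+ k * Abar M t s)%:E =
     \int[@lebesgue_measure R]_(t in `[0%R, 1%R]) ((A \o swap) (s, t) * t ^+ k)%:E)%E.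
    move=> s01; apply: eq_integral => t; rewrite inE/= in_itv/= => t01.
    by rewrite hB// hC// mul1r mulrC.
  split=> H k hk.
  - have := H k.+1; rewrite subSS subn0 => /(_ _)/wrap[]; first by lia.
    refine (ae_imply _ _ _ _ _ _ _) => s + s01 => /(_ s01).
    rewrite E// hB// hC// => ->; congr EFin.
    rewrite !(hornerD, hornerN, hornerZ, hornerC) hornerXn hornerX addn1.
    by rewrite !mul1r [_^-1 * _]mulrC [_^-1 * s]mulrC.
  - case: k hk => // k hk; have := H k; rewrite subSS subn0 => /(_ _)/wrap[]; first by lia.
    refine (ae_imply _ _ _ _ _ _ _) => s + s01 => /(_ s01).
    rewrite E// hB// hC// => ->; congr EFin.
    rewrite !(hornerD, hornerN, hornerZ, hornerC) hornerXn hornerX addn1.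
    by rewrite !mul1r [_^-1 * _]mulrC [_^-1 * s]mulrC.
rewrite CNE DNE; split=> [[cn dn]|[omega [S [SS AS]]]].
  have [omega SS] := double_sum_of_moments0 _ _ _ D2 cn dn.
  (* The remainder itself serves as the L^2 sum, so the expansion holds at every point. *)
  exists omega, (fun x => A x - (K x.1).[x.2]); split => //.
  by apply: aeW => x _ /=; rewrite /K horner_kerP addrC subrK.
apply: moments0_of_double_sum D2 SS _.
move: AS; refine (ae_imply _ _ _ _ _ _ _) => x + xs => /(_ xs) /=.
by rewrite /A /K horner_kerP => ->; rewrite addrC addKr.
Qed.
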